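(* Let $T$ be a homogeneous or semi-homogeneous tree. The diagram formed by $\mathcal R_F:\ell^1(F)\to\mathbb C^{\mathcal H_F}$, $\widetilde\pi_E\times\widetilde\pi_V:\ell^1(F)\to\ell^1(E)\times\ell^1(V)$, $\mathcal R_E\times\mathcal R_V:\ell^1(E)\times\ell^1(V)\to\mathbb C^{\mathcal H_E}\times\mathbb C^{\mathcal H_V}$ and $\widetilde\pi_E\times\widetilde\pi_V:\mathbb C^{\mathcal H_F}\to\mathbb C^{\mathcal H_E}\times\mathbb C^{\mathcal H_V}$ is commutative, that is, $$(\widetilde\pi_E\times\widetilde\pi_V)\circ\mathcal R_F=(\mathcal R_E\times\mathcal R_V)\circ(\widetilde\pi_E\times\widetilde\pi_V)\quad\text{on }\ell^1(F).$$ Hence the inverse flag-horospherical Radon transform (defined on the image of $\ell^1(F)$ under $\mathcal R_F$) is given by $$\mathcal R_F^{-1}=(\widetilde\pi_E\times\widetilde\pi_V)^{-1}\circ(\mathcal R_E^{-1}\times\mathcal R_V^{-1})\circ(\widetilde\pi_E\times\widetilde\pi_V),$$ where $\mathcal R_E^{-1}$, $\mathcal R_V^{-1}$ are the inverses of the (injective) transforms $\mathcal R_E$ on $\ell^1(E)$ and $\mathcal R_V$ on $\ell^1(V)$, defined on their ranges, and $(\widetilde\pi_E\times\widetilde\pi_V)^{-1}$ is the inverse of the (injective) map $\widetilde\pi_E\times\widetilde\pi_V:\ell^1(F)\to\ell^1(E)\times\ell^1(V)$, defined on its range.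
   Context: $T$ is a tree with vertex set $V$ and unoriented edge set $E$; homogeneous: every vertex has $q+1$ neighbours ($q\ge1$); semi-homogeneous: vertices have $q_++1$ or $q_-+1$ neighbours ($q_\pm\ge1$), alternating between adjacent vertices. A flag is a pair $f=(e,v)$ with $e\in E$ and $v$ an endpoint of $e$; $F$ is the set of flags, $\pi_E(e,v)=e$, $\pi_V(e,v)=v$. $\Omega$ is the set of ends (equivalence classes of geodesic rays that eventually coincide). Indices: $h(v,v_0,\omega)=\operatorname{dist}(v_0,w)-\operatorname{dist}(v,w)$ for any $w$ far enough along the ray from $v_0$ to $\omega$; $h(e,e_0,\omega)=h(v(e,\omega),v(e_0,\omega),\omega)$, with $v(e,\omega)$ the endpoint of $e$ closer to $\omega$; $h(f,f_0,\omega)=(h(e,e_0,\omega),h(v,v_0,\omega))$ for flags $f=(e,v)$, $f_0=(e_0,v_0)$. Vertex-, edge- and flag-horospheres tangent at $\omega$ are the (nonempty) level sets of these indices for fixed $\omega$ and fixed reference element (they do not depend on the reference element). $\mathcal H_V,\mathcal H_E,\mathcal H_F$ are the sets of all vertex-, edge-, flag-horospheres, each with its tangency point. The vertices (edges) of the flags in a flag-horosphere tangent at $\omega$ form a vertex-horosphere (edge-horosphere) tangent at $\omega$; this defines two-to-one maps $\pi_V:\mathcal H_F\to\mathcal H_V$ and $\pi_E:\mathcal H_F\to\mathcal H_E$. The Radon transforms $\mathcal R_V,\mathcal R_E,\mathcal R_F$ map $\ell^1$ functions on $V,E,F$ to functions on $\mathcal H_V,\mathcal H_E,\mathcal H_F$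 by summation over each horosphere. The projections of functions are $\widetilde\pi_Vu(v)=\sum_{f:\pi_Vf=v}u(f)$ and $\widetilde\pi_Eu(e)=\sum_{f:\pi_Ef=e}u(f)$ for $u\in\ell^1(F)$, and similarly, for $U:\mathcal H_F\to\mathbb C$, $\widetilde\pi_VU(\mathbf h)=\sum_{\mathbf k:\pi_V\mathbf k=\mathbf h}U(\mathbf k)$ on $\mathcal H_V$ and $\widetilde\pi_EU(\mathbf h)=\sum_{\mathbf k:\pi_E\mathbf k=\mathbf h}U(\mathbf k)$ on $\mathcal H_E$. *)

(* Defs.v *)
From HB Require Import structures.
From mathcomp Require Import all_boot all_order all_algebra.
From mathcomp Require Import all_classical all_reals all_analysis.
From mathcomp Require Import complex.

Set Implicit Arguments.
Unset Strict Implicit.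
Unset Printing Implicit Defensive.

Import Order.TTheory GRing.Theory Num.Theory.
Local Open Scope classical_set_scope.
Local Open Scope ring_scope.

(** ** Trees *)

Record tree := Tree {
  vertex : choiceType;
  adj : rel vertex;
  adj_sym : symmetric adj;
  adj_irr : irreflexive adj;
  tree_connected : forall x y, exists p, path adj x p /\ last x p = y;
  (* [ucycle] also holds of [:: x; y] when x and y are adjacent. *)
  tree_acyclic : forall c, ucycle adj c -> (size c <= 2)%N }.

Definition has_degree (T : tree) (x : vertex T) (d : nat) : Prop :=
  ([set y | adj x y] #= `I_d)%card.

Definition homogeneous (T : tree) : Prop :=
  exists2 q : nat, (1 <= q)%N & forall x : vertex T, has_degree x q.+1.

Definition semihomogeneous (T : tree) : Prop :=
  exists (qp qm : nat) (s : vertex T -> bool),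
    [/\ (1 <= qp)%N, (1 <= qm)%N,
        forall x y, adj x y -> s y = ~~ s x
      & forall x, has_degree x (if s x then qp.+1 else qm.+1)].

Lemma dist_subproof (T : tree) (x y : vertex T) :
  exists n, `[< exists p, [/\ path (@adj T) x p, last x p = y & size p = n] >].
Proof.
by have [p [xp py]] := tree_connected x y; exists (size p); apply/asboolP; exists p.
Qed.

Definition dist (T : tree) (x y : vertex T) : nat := ex_minn (dist_subproof x y).

Definition edges (T : tree) : set (set (vertex T)) :=
  [set e | exists x y, adj x y /\ e = [set x; y]].

Definition edge (T : tree) : choiceType := set_type (@edges T).

Definition flags (T : tree) : set (edge T * vertex T) :=
  [set f | val f.1 f.2].

Definition flag (T : tree) : choiceType := set_type (@flags T).

Definition flagE (T : tree) (f : flag T) : edge T := (val f).1.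
Definition flagV (T : tree) (f : flag T) : vertex T := (val f).2.

(** ** Ends *)

Definition rays (T : tree) : set (nat -> vertex T) :=
  [set r | forall m n, (m <= n)%N -> dist (r m) (r n) = (n - m)%N].

Definition eventually_coincide (T : tree) (r s : nat -> vertex T) : Prop :=
  exists m n, forall k, r (m + k)%N = s (n + k)%N.

Definition ends (T : tree) : set (set (nat -> vertex T)) :=
  [set w | exists2 r, @rays T r
                    & w = [set s | @rays T s /\ eventually_coincide r s]].

Definition End (T : tree) : choiceType := set_type (@ends T).

(** ** Horospherical indices and horospheres *)

(* The set below is a singleton in every tree; the default 0 is a dummy. *)
Definition indexV (T : tree) (v v0 : vertex T) (w : End T) : int :=
  xget 0 [set n : int | exists r, [/\ val w r, r 0%N = v0
    & \forall k \near \oo, (dist v0 (r k))%:Z - (dist v (r k))%:Z = n]].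

Lemma edge_nonempty (T : tree) (e : edge T) : exists v, val e v.
Proof. by case: e => e /= /set_mem[x [y [_ ->]]]; exists x; left. Qed.

(* The endpoint of e closer to w: eventually along every ray of w it is strictly
   closer than the other endpoint. It exists and is unique in every tree, so the
   default of [xget] is a dummy. *)
Definition edge_end (T : tree) (e : edge T) (w : End T) : vertex T :=
  xget (projT1 (cid (edge_nonempty e)))
    [set v | val e v /\ forall v' r, val e v' -> v' <> v -> val w r ->
      \forall k \near \oo, (dist v (r k) < dist v' (r k))%N].

Definition indexE (T : tree) (e e0 : edge T) (w : End T) : int :=
  indexV (edge_end e w) (edge_end e0 w) w.

Definition indexF (T : tree) (f f0 : flag T) (w : End T) : int * int :=
  (indexE (flagE f) (flagE f0) w, indexV (flagV f) (flagV f0) w).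

(* A horosphere is stored together with its tangency point. *)
Definition horospheres (T : tree) (X : choiceType) (I : Type)
    (index : X -> X -> End T -> I) : set (End T * set X) :=
  [set h | h.2 !=set0 /\
           exists x0 n, h.2 = [set x | index x x0 h.1 = n]].

Definition HV (T : tree) : choiceType := set_type (horospheres (@indexV T)).
Definition HE (T : tree) : choiceType := set_type (horospheres (@indexE T)).
Definition HF (T : tree) : choiceType := set_type (horospheres (@indexF T)).

(* The projection of a flag-horosphere k to HV (resp. HE), given by its
   underlying pair (tangency point, set of vertices (resp. edges)). *)
Definition horoV (T : tree) (k : HF T) : End T * set (vertex T) :=
  ((val k).1, @flagV T @` (val k).2).
Definition horoE (T : tree) (k : HF T) : End T * set (edge T) :=
  ((val k).1, @flagE T @` (val k).2).

(** ** Summable functions and sums *)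

Definition l1 (R : realType) (X : choiceType) : set (X -> R[i]) :=
  [set u | summable [set: X] (fun x => (ComplexField.Normc.normc (u x))%:E)].
Arguments l1 R X : clear implicits.

(* Unordered sums over A; meaningful for summable u. *)
Definition rsum (R : realType) (X : choiceType) (A : set X) (u : X -> R) : R :=
  fine (\esum_(x in A) (EFin \o u)^\+ x)%E - fine (\esum_(x in A) (EFin \o u)^\- x)%E.

Definition csum (R : realType) (X : choiceType) (A : set X) (u : X -> R[i])
    : R[i] :=
  Complex (rsum A (fun x => complex.Re (u x))) (rsum A (fun x => complex.Im (u x))).

(** ** Radon transforms and projections of functions *)

Definition radonV (R : realType) (T : tree) (u : vertex T -> R[i]) : HV T -> R[i] :=
  fun h => csum (val h).2 u.
Definition radonE (R : realType) (T : tree) (u : edge T -> R[i]) : HE T -> R[i] :=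
  fun h => csum (val h).2 u.
Definition radonF (R : realType) (T : tree) (u : flag T -> R[i]) : HF T -> R[i] :=
  fun h => csum (val h).2 u.

(* The index sets of the four sums below are finite in a tree that is
   homogeneous or semi-homogeneous. *)
Definition projV (R : realType) (T : tree) (u : flag T -> R[i]) : vertex T -> R[i] :=
  fun v => \sum_(f \in [set f | flagV f = v]) u f.
Definition projE (R : realType) (T : tree) (u : flag T -> R[i]) : edge T -> R[i] :=
  fun e => \sum_(f \in [set f | flagE f = e]) u f.
Definition projHV (R : realType) (T : tree) (U : HF T -> R[i]) : HV T -> R[i] :=
  fun h => \sum_(k \in [set k | horoV k = val h]) U k.
Definition projHE (R : realType) (T : tree) (U : HF T -> R[i]) : HE T -> R[i] :=
  fun h => \sum_(k \in [set k | horoE k = val h]) U k.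

Definition projEV (R : realType) (T : tree) (u : flag T -> R[i])
    : (edge T -> R[i]) * (vertex T -> R[i]) :=
  (projE u, projV u).
Definition projHEV (R : realType) (T : tree) (U : HF T -> R[i])
    : (HE T -> R[i]) * (HV T -> R[i]) :=
  (projHE U, projHV U).

Definition prodmap (A B C D : Type) (f : A -> C) (g : B -> D) (p : A * B) : C * D :=
  (f p.1, g p.2).

(** ** Inverses *)

(* Inverses of the restrictions to the l1 spaces: they are defined on the image
   of l1, the value 0 taken elsewhere being a dummy. *)
Definition radonV_inv (R : realType) (T : tree)
    : (HV T -> R[i]) -> (vertex T -> R[i]) :=
  'pinv_(fun=> cst 0) (l1 R (vertex T)) (@radonV R T).
Definition radonE_inv (R : realType) (T : tree)
    : (HE T -> R[i]) -> (edge T -> R[i]) :=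
  'pinv_(fun=> cst 0) (l1 R (edge T)) (@radonE R T).
Definition radonF_inv (R : realType) (T : tree)
    : (HF T -> R[i]) -> (flag T -> R[i]) :=
  'pinv_(fun=> cst 0) (l1 R (flag T)) (@radonF R T).
Definition projEV_inv (R : realType) (T : tree)
    : (edge T -> R[i]) * (vertex T -> R[i]) -> (flag T -> R[i]) :=
  'pinv_(fun=> cst 0) (l1 R (flag T)) (@projEV R T).

(* Main.v *)
Require Import Defs.
From mathcomp Require Import all_boot all_order all_algebra.
From mathcomp Require Import all_classical all_reals all_analysis.
From mathcomp Require Import complex.
From mathcomp Require Import finmap zify ring lra.

Set Implicit Arguments.
Unset Strict Implicit.
Unset Printing Implicit Defensive.
Import Order.TTheory GRing.Theory Num.Theory.
Local Open Scope classical_set_scope.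
Local Open Scope ring_scope.

(** Fix an end [w].  The horospherical index is a difference [b v - b v0] of values
    of a Busemann function [b], which changes by one along each edge, every vertex
    having exactly one neighbour (its parent) of larger height.  Hence a vertex (or
    edge) horosphere lifts to exactly two flag horospheres, and the diagram commutes
    by summation over fibres.

    Injectivity of [R_V]: for an oriented edge [(p, z)] let [B_n (p, z)] be the sum
    of [u] over the vertices at distance [n] from [z] on the side of [z].  If the
    sums of [u] over horospheres vanish, then for every end on the side of [z] the
    part of a horosphere on that side has sum [- B_n (z, p)].  Summing over the
    descendants [f] of [(p, z)] at depth [m], the numbers
    [K_m = sum_f B_(n + m) (reversed f)] satisfy
    [q_m K_m = K_(m+1) - (q_m - 1) B_(n + 2m + 1) (p, z)] and tend to [0], so that
    [|B_n (z, p)|] is at most the supremum of [|B_j (p, z)|] over [j > n].  Using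
    this for both orientations, all [B_j] vanish since they tend to [0]; in
    particular [u z = B_0 (p, z) = 0].  The same argument gives [R_E], applied to
    the function sending a vertex [v] to the value of [u] at the edge leading from
    [v] toward a fixed edge: below the fixed edge, that edge is the one from [v] to
    its parent.

    Injectivity of the projection: a function on flags with zero sums at every edge
    and every vertex is a flow without sources on the tree, so its total over the
    descendants at depth [m] of an oriented edge does not depend on [m]; for a
    summable function this total tends to [0]. *)

(** * Unordered sums *)

Section RealSums.
Variable R : realType.
Implicit Types X Y : choiceType.

Definition rsummable X (u : X -> R) := summable [set: X] (EFin \o u).

Lemma esum_subset X (A B : set X) (a : X -> \bar R) :
  A `<=` B -> (\esum_(x in A) a x <= \esum_(x in B) a x)%E.
Proof.
move=> AB; apply: ge_ereal_sup => _ [F [finF FA] <-].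
by apply: ereal_sup_ubound; exists F => //; split=> // x /FA /AB.
Qed.

Lemma esum_preimage X Y (f : X -> Y) (A : set Y) (a : X -> \bar R) :
  (forall x, 0 <= a x)%E ->
  (\esum_(x in f @^-1` A) a x = \esum_(y in A) \esum_(x in f @^-1` [set y]) a x)%E.
Proof.
move=> a0; rewrite esum_esum//.
apply/esym; rewrite (reindex_esum (f @^-1` A) _ (fun x => (f x, x)))//; split=> //.
  by move=> x y _ _ [].
move=> [y x] [/= Ay fx]; exists x; rewrite /= ?fx//.
Qed.

Lemma rsummable_le X (u v : X -> R) :
  (forall x, `|u x| <= `|v x|) -> rsummable v -> rsummable u.
Proof.
move=> uv; apply: le_lt_trans; apply: le_esum => x _ /=.
by rewrite lee_fin uv.
Qed.

Lemma rsummableD X (u v : X -> R) :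
  rsummable u -> rsummable v -> rsummable (fun x => u x + v x).
Proof. by move=> su sv; have := summableD su sv; apply: le_lt_trans; apply: le_esum. Qed.

Lemma rsummableN X (u : X -> R) : rsummable u -> rsummable (fun x => - u x).
Proof. by apply: rsummable_le => x; rewrite normrN. Qed.

Lemma rsummableB X (u v : X -> R) :
  rsummable u -> rsummable v -> rsummable (fun x => u x - v x).
Proof. by move=> su sv; apply: rsummableD => //; apply: rsummableN. Qed.

Lemma rsummable_norm X (u : X -> R) : rsummable u -> rsummable (fun x => `|u x|).
Proof. by apply: rsummable_le => x; rewrite normr_id. Qed.

Lemma rsummable_pos X (u : X -> R) : rsummable u -> rsummable (fun x => Num.max (u x) 0).
Proof.
apply: rsummable_le => x; rewrite ger0_norm ?le_max ?lexx ?orbT//.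
by rewrite ge_max ler_norm normr_ge0.
Qed.

Lemma rsummable_neg X (u : X -> R) :
  rsummable u -> rsummable (fun x => Num.max (- u x) 0).
Proof. by move/rsummableN/rsummable_pos. Qed.

Lemma rsummable_fin_num X (A : set X) (u : X -> R) :
  (forall x, 0 <= u x) -> rsummable u -> (\esum_(x in A) (u x)%:E)%E \is a fin_num.
Proof.
move=> u0 su; rewrite ge0_fin_numE; last by apply: esum_ge0 => x _; rewrite lee_fin.
apply: le_lt_trans su; apply: le_trans (esum_subset _ (@subsetT _ A)) _.
by apply: le_esum => x _ /=; rewrite lee_fin ler_norm.
Qed.

Lemma ge0_rsummable X (u : X -> R) (M : \bar R) : (forall x, 0 <= u x) ->
  (\esum_(x in [set: X]) (u x)%:E <= M)%E -> (M < +oo)%E -> rsummable u.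
Proof.
move=> u0 uM; apply: le_lt_trans; apply: le_trans uM.
by apply: le_esum => x _ /=; rewrite lee_fin ger0_norm.
Qed.

Local Notation nsum A u := (fine (\esum_(x in A) (u x)%:E)%E).

Lemma rsum_posneg X (A : set X) (u : X -> R) :
  rsum A u = nsum A (fun x => Num.max (u x) 0) - nsum A (fun x => Num.max (- u x) 0).
Proof.
by congr (fine _ - fine _); apply: eq_esum => x _;
  rewrite ?funeposE ?funenegE EFin_max.
Qed.

(** [u] and [v] may overlap, so they need not be the positive and negative parts of the difference.
    Additivity and summation over fibres rest on this freedom. *)
Lemma rsum_sub X (A : set X) (u v : X -> R) :
  (forall x, 0 <= u x) -> (forall x, 0 <= v x) -> rsummable u -> rsummable v ->
  rsum A (fun x => u x - v x) = nsum A u - nsum A v.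
Proof.
move=> u0 v0 su sv.
have sub w : rsummable w -> summable A (EFin \o w).
  by apply: le_lt_trans; apply: esum_subset.
have max0 (r : R) : 0 <= Num.max r 0 by rewrite le_max lexx orbT.
have suv := rsummableB su sv.
have := esumB (sub _ su) (sub _ sv) (fun x _ => u0 x) (fun x _ => v0 x).
move=> /(congr1 (@fine _)).
rewrite [RHS]fineB ?rsummable_fin_num//= => <-.
rewrite rsum_posneg -fineB ?rsummable_fin_num//.
- by congr (fine (_ - _)); apply: eq_esum => x _; rewrite ?funeposE ?funenegE EFin_max.
- exact: rsummable_pos.
- exact: rsummable_neg.
Qed.

Lemma ge0_rsumE X (A : set X) (u : X -> R) : (forall x, 0 <= u x) -> rsum A u = nsum A u.
Proof.
move=> u0; rewrite rsum_posneg [X in _ - X](_ : _ = 0) ?subr0.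
  by congr fine; apply: eq_esum => x _; rewrite max_l.
by rewrite esum1// => x _; rewrite max_r// oppr_le0.
Qed.

Lemma rsum_ge0 X (A : set X) (u : X -> R) : (forall x, 0 <= u x) -> 0 <= rsum A u.
Proof.
by move=> u0; rewrite ge0_rsumE// fine_ge0// esum_ge0// => x _; rewrite lee_fin.
Qed.

Lemma eq_rsum X (A : set X) (u v : X -> R) :
  (forall x, A x -> u x = v x) -> rsum A u = rsum A v.
Proof.
move=> uv; rewrite !rsum_posneg.
by congr (fine _ - fine _); apply: eq_esum => x /uv ->.
Qed.

Let posneg (r : R) : r = Num.max r 0 - Num.max (- r) 0.
Proof.
have [r0|r0] := leP 0 r; first by rewrite max_r ?subr0// oppr_le0.
by rewrite max_l ?opprK ?add0r// oppr_ge0 ltW.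
Qed.

Let max0 (r : R) : 0 <= Num.max r 0. Proof. by rewrite le_max lexx orbT. Qed.

Lemma rsumD X (A : set X) (u v : X -> R) : rsummable u -> rsummable v ->
  rsum A (fun x => u x + v x) = rsum A u + rsum A v.
Proof.
move=> su sv; rewrite [in RHS]rsum_posneg [in RHS]rsum_posneg.
pose p (w : X -> R) x := Num.max (w x) 0; pose n (w : X -> R) x := Num.max (- w x) 0.
rewrite (@eq_rsum _ _ _ (fun x => (p u x + p v x) - (n u x + n v x))); last first.
  by move=> x _; rewrite [in LHS](posneg (u x)) [in LHS](posneg (v x)) /p /n; ring.
have [pu pv] := (rsummable_pos su, rsummable_pos sv).
have [nu nv] := (rsummable_neg su, rsummable_neg sv).
rewrite rsum_sub; try (by move=> x; rewrite addr_ge0 ?max0); try exact: rsummableD.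
have E a b : (forall x, 0 <= a x) -> (forall x, 0 <= b x) -> rsummable a ->
    rsummable b -> nsum A (fun x => a x + b x) = nsum A a + nsum A b.
  move=> a0 b0 sa sb; rewrite -fineD ?rsummable_fin_num// -esumD//.
  by move=> *; rewrite lee_fin.
  by move=> *; rewrite lee_fin.
by rewrite !E// /p /n; try (by move=> ?; exact: max0); ring.
Qed.

Lemma rsumN X (A : set X) (u : X -> R) : rsum A (fun x => - u x) = - rsum A u.
Proof.
rewrite !rsum_posneg opprB; congr (_ - fine _).
by apply: eq_esum => x _; rewrite opprK.
Qed.

Lemma rsumB X (A : set X) (u v : X -> R) : rsummable u -> rsummable v ->
  rsum A (fun x => u x - v x) = rsum A u - rsum A v.
Proof. by move=> su sv; rewrite rsumD ?rsumN//; exact: rsummableN. Qed.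

Lemma le_rsum X (A : set X) (u v : X -> R) : rsummable u -> rsummable v ->
  (forall x, u x <= v x) -> rsum A u <= rsum A v.
Proof.
move=> su sv uv; rewrite -subr_ge0 -rsumB//.
by apply: rsum_ge0 => x; rewrite subr_ge0.
Qed.

Lemma ler_norm_rsum X (A : set X) (u : X -> R) :
  rsummable u -> `|rsum A u| <= rsum A (fun x => `|u x|).
Proof.
move=> su; rewrite ler_norml -rsumN; apply/andP; split; apply: le_rsum => //.
- exact/rsummableN/rsummable_norm.
- by move=> x; rewrite lerNl -normrN ler_norm.
- exact: rsummable_norm.
- by move=> x; exact: ler_norm.
Qed.

Lemma rsum_subset X (A B : set X) (u : X -> R) : rsummable u ->
  (forall x, 0 <= u x) -> A `<=` B -> rsum A u <= rsum B u.
Proof.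
move=> su u0 AB; rewrite !ge0_rsumE// fine_le ?rsummable_fin_num//.
exact: esum_subset.
Qed.

Lemma rsumID X (B A : set X) (u : X -> R) : rsummable u ->
  rsum A u = rsum (A `&` B) u + rsum (A `&` ~` B) u.
Proof.
move=> su; rewrite !rsum_posneg.
have E a : (forall x, 0 <= a x) -> rsummable a ->
    nsum A a = nsum (A `&` B) a + nsum (A `&` ~` B) a.
  move=> a0 sa; rewrite -fineD ?rsummable_fin_num// -esumID//.
  by move=> *; rewrite lee_fin.
rewrite (E (fun x => Num.max (u x) 0)) ?(E (fun x => Num.max (- u x) 0))//.
- by ring.
- exact: rsummable_neg.
- exact: rsummable_pos.
Qed.

Lemma rsum_set0 X (u : X -> R) : rsum set0 u = 0.
Proof. by rewrite rsum_posneg !esum_set0 subr0. Qed.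

Lemma rsum_set1 X (x : X) (u : X -> R) : rsum [set x] u = u x.
Proof. by rewrite rsum_posneg !esum_set1 ?lee_fin//= -posneg. Qed.

Lemma rsum_cover X (I : eqType) (s : seq I) (B : I -> set X) (A : set X) (u : X -> R) :
  rsummable u -> uniq s ->
  (forall i j x, i \in s -> j \in s -> B i x -> B j x -> i = j) ->
  (forall x, A x <-> exists2 i, i \in s & B i x) ->
  rsum A u = \sum_(i <- s) rsum (B i) u.
Proof.
move=> su; elim: s A => [|i s IH] A.
  move=> _ _ AB; rewrite big_nil (_ : A = set0) ?rsum_set0//.
  by apply/seteqP; split=> // x /AB[].
move=> /= /andP[is' us] disj AB; rewrite big_cons (rsumID (B i))//; congr (_ + _).
  congr rsum; apply/seteqP; split=> [x []//|x Bx]; split=> //.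
  by apply/AB; exists i; rewrite ?mem_head.
apply: IH => // [j k x js ks|x]; first by apply: disj; rewrite inE ?js ?ks orbT.
split=> [[/AB[j]]|[j js Bj]].
  by rewrite inE => /orP[/eqP->//|js] Bj _; exists j.
split; first by apply/AB; exists j => //; rewrite inE js orbT.
move=> Bi; have := disj i j x; rewrite mem_head inE js orbT => /(_ erefl erefl).
by move=> /(_ Bi Bj) ij; rewrite ij js in is'.
Qed.

Lemma rsum_finite X (A : set X) (u : X -> R) : rsummable u -> finite_set A ->
  rsum A u = \sum_(x \in A) u x.
Proof.
move=> su fA; rewrite fsbig_finite//=.
rewrite (@rsum_cover _ _ (enum_fset (fset_set A)) set1 A u)//.
- by apply: eq_bigr => x _; rewrite rsum_set1.
- by move=> i j x _ _ -> ->.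
- move=> x; split=> [Ax|[y yA ->]]; last by apply: set_mem; rewrite -in_fset_set.
  by exists x => //; rewrite -[_ \in _]/(x \in fset_set A) in_fset_set//; exact: mem_set.
Qed.

Lemma rsum_bij X Y (e : X -> Y) (A : set X) (B : set Y) (u : Y -> R) :
  set_bij A B e -> rsum B u = rsum A (u \o e).
Proof. by move=> AB; rewrite !rsum_posneg !(reindex_esum _ _ _ _ AB). Qed.

Lemma ge0_rsummable_fibre X Y (f : X -> Y) (u : X -> R) : (forall x, 0 <= u x) ->
  rsummable u -> rsummable (fun y => nsum (f @^-1` [set y]) u).
Proof.
move=> u0 su; apply: (@ge0_rsummable _ _ (\esum_(x in [set: X]) (u x)%:E)%E).
- by move=> y; rewrite fine_ge0// esum_ge0// => x _; rewrite lee_fin.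
- rewrite -[[set: X]](preimage_setT f) esum_preimage; last by move=> *; rewrite lee_fin.
  by apply: le_esum => y _; rewrite fineK// rsummable_fin_num.
- by rewrite -ge0_fin_numE ?rsummable_fin_num// esum_ge0// => *; rewrite lee_fin.
Qed.

Lemma rsummable_fibre X Y (f : X -> Y) (u : X -> R) :
  rsummable u -> rsummable (fun y => rsum (f @^-1` [set y]) u).
Proof.
move=> su; apply: (rsummable_le _ (ge0_rsummable_fibre f _ (rsummable_norm su))) => // y.
rewrite -(ge0_rsumE _ (fun x => normr_ge0 (u x))).
by rewrite (le_trans (ler_norm_rsum _ su))// ler_norm.
Qed.

Lemma rsum_preimage X Y (f : X -> Y) (A : set Y) (u : X -> R) : rsummable u ->
  rsum (f @^-1` A) u = rsum A (fun y => rsum (f @^-1` [set y]) u).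
Proof.
move=> su; have [pu nu] := (rsummable_pos su, rsummable_neg su).
rewrite rsum_posneg; under [RHS]eq_rsum do rewrite rsum_posneg.
have n0 (a : X -> R) (y : Y) : (forall x, 0 <= a x) -> 0 <= nsum (f @^-1` [set y]) a.
  by move=> a0; apply: fine_ge0; apply: esum_ge0 => x _; rewrite lee_fin.
rewrite rsum_sub; try (by move=> y; apply: n0);
  try exact: ge0_rsummable_fibre.
have E a : (forall x, 0 <= a x) -> rsummable a ->
    nsum (f @^-1` A) a = nsum A (fun y => nsum (f @^-1` [set y]) a).
  move=> a0 sa; congr fine; rewrite esum_preimage; last by move=> *; rewrite lee_fin.
  by apply: eq_esum => y _; rewrite fineK// rsummable_fin_num.
by rewrite !E.
Qed.

(** Some finite [F] carries all but [e] of the sum of [|u|]; a set on which [d] exceeds its maximum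
    over [F] avoids [F]. *)
Lemma rsum_tail X (u : X -> R) (d : X -> nat) (e : R) : rsummable u -> 0 < e ->
  exists N, forall n A, (N <= n)%N -> A `<=` [set x | (n <= d x)%N] ->
    rsum A (fun x => `|u x|) <= e.
Proof.
move=> su e0; have sn := rsummable_norm su.
have n0 x : 0 <= `|u x| by [].
have fT := rsummable_fin_num [set: X] n0 sn.
have : ((rsum setT (fun x => `|u x|) - e)%:E < \esum_(x in [set: X]) `|u x|%:E)%E.
  by rewrite -(fineK fT) lte_fin ge0_rsumE// ltrBlDr ltrDl.
move=> /ereal_sup_gt[_ [F [finF _] <-]]; rewrite fsbig_finite// sumEFin lte_fin.
rewrite -fsbig_finite//= -rsum_finite// => lt.
exists (\max_(x <- fset_set F) d x).+1 => n A Nn An.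
have AF : A `<=` ~` F.
  move=> x /An /= nx Fx; suff: (d x <= \max_(x <- fset_set F) d x)%N by lia.
  by rewrite (big_rem x)/= ?leq_maxl// -[_ \in _]/(x \in fset_set F) in_fset_set// mem_set.
have := rsumID F setT sn; rewrite !setTI => E.
have := rsum_subset sn n0 AF; move: lt; rewrite E; lra.
Qed.

End RealSums.

(** * Distances in a tree *)

Section TreeDistance.
Variable T : tree.
Implicit Types x y z v w : vertex T.
Local Open Scope nat_scope.

Lemma distP x y :
  exists p, [/\ path (@adj T) x p, last x p = y & size p = dist x y].
Proof. by rewrite /dist; case: ex_minnP => n /asboolP. Qed.

Lemma dist_le x p : path (@adj T) x p -> dist x (last x p) <= size p.
Proof.
by move=> xp; rewrite /dist; case: ex_minnP => n _; apply; apply/asboolP; exists p.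
Qed.

Lemma distxx x : dist x x = 0.
Proof. by apply/eqP; rewrite -leqn0; exact: (@dist_le x [::]). Qed.

Lemma dist_eq0 x y : (dist x y == 0) = (x == y).
Proof.
apply/eqP/eqP => [d0|->]; last exact: distxx.
by have [[|? ?] [_ /= yp]] := distP x y; rewrite ?d0 // -yp.
Qed.

Lemma dist_sym_le x y : dist y x <= dist x y.
Proof.
have [p [xp yp <-]] := distP x y.
have := @dist_le (last x p) (rev (belast x p)).
rewrite size_rev size_belast yp (_ : last y _ = x); last first.
  by case: p {xp} yp => [|a p]/= yp; rewrite ?rev_cons ?last_rcons ?yp.
apply; rewrite -yp rev_path; apply: sub_path xp => a b.
by rewrite adj_sym.
Qed.

Lemma distC x y : dist x y = dist y x.
Proof. by apply/eqP; rewrite eqn_leq !dist_sym_le. Qed.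

Lemma dist_triangle y x z : dist x z <= dist x y + dist y z.
Proof.
have [p [xp yp <-]] := distP x y; have [q [yq zq <-]] := distP y z.
have := @dist_le x (p ++ q); rewrite cat_path xp yp yq last_cat yp zq size_cat.
exact.
Qed.

Lemma adj_neq x y : adj x y -> x != y.
Proof. by apply: contraTneq => ->; rewrite adj_irr. Qed.

Lemma dist1 x y : (dist x y == 1) = adj x y.
Proof.
apply/idP/idP => [/eqP d1|xy].
  have [[|a [|? ?]] [/= xp yp]] := distP x y; rewrite d1 // => _.
  by move: xp; rewrite andbT yp.
have := @dist_le x [:: y]; rewrite /= xy => /(_ isT).
have := adj_neq xy; rewrite -dist_eq0; lia.
Qed.

Lemma adj_dist x y : adj x y -> dist x y = 1.
Proof. by rewrite -dist1 => /eqP. Qed.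

Lemma dist_closer x v : v != x -> exists2 w, adj v w & dist x v = (dist x w).+1.
Proof.
rewrite -dist_eq0 => vx; have [[|w p] [/= vp xp sp]] := distP v x.
  by rewrite -sp in vx.
move: vp => /andP[vw wp]; exists w => //.
have := dist_le wp; rewrite xp.
have := dist_triangle w v x; rewrite (adj_dist vw) (distC x v) (distC x w) -sp; lia.
Qed.

(** Removing a repetition would give a shorter path with the same ends. *)
Lemma geodesic_uniq x p : path (@adj T) x p -> size p = dist x (last x p) -> uniq (x :: p).
Proof.
move=> xp; case: (shortenP xp) => p' xp' up' sub sp.
have := dist_le xp'; rewrite -sp => ge.
apply: (leq_size_uniq up') => //.
by move=> a; rewrite !inE => /orP[->//|/sub ->]; rewrite orbT.
Qed.

(** If the paths part, following [q] to its first later vertex on [p] and returning along [p] closes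
    a cycle. *)
Lemma upath_inj x p q : path (@adj T) x p -> uniq (x :: p) ->
  path (@adj T) x q -> uniq (x :: q) -> last x p = last x q -> p = q.
Proof.
have nil y s : uniq (y :: s) -> last y s = y -> s = [::].
  by case: s => //= a s /andP[+ _] E; rewrite -{1}E mem_last.
elim: p x q => [|a p IH] x q xp up xq uq E; first by rewrite (nil _ _ uq).
case: q => [|b q] in xq uq E *; first by apply: (nil _ _ up).
have [ab|ab] := eqVneq a b.
  subst b; congr cons; apply: (IH a) => //.
  - by case/andP: xp.
  - by case/andP: up.
  - by case/andP: xq.
  - by case/andP: uq.
exfalso; move: xp up xq uq E; set P := a :: p; set Q := b :: q => xp up xq uq E.
have hasQ : has (mem P) Q.
  apply/hasP; exists (last x Q); first by rewrite /= mem_last.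
  by rewrite -E /= mem_last.
have [c [q1 [q2 [Pc nq1 QE]]]] :
    exists c q1 q2, [/\ c \in P, ~~ has (mem P) q1 & Q = q1 ++ c :: q2].
  case: (split_find hasQ) => c q1 q2 Pc nq; exists c, q1, q2.
  by rewrite cat_rcons.
have [p1 [p2 PE]] : exists p1 p2, P = p1 ++ c :: p2.
  by case/splitPr: Pc => p1 p2; exists p1, p2.
(* This cycle has at least three vertices, since [p1] and [q1] both empty would force [a = b]. *)
suff /(@tree_acyclic T) : ucycle (@adj T) (x :: p1 ++ c :: rev q1).
  rewrite /= size_cat /= size_rev.
  case: p1 q1 PE QE {nq1} => [|? ?] [|? ?]; rewrite /= ?addnS //= /P /Q.
  by case=> <- _ [] ba; rewrite ba eqxx in ab.
apply/andP; split.
  rewrite /= rcons_cat cat_path /= rcons_path.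
  move: xp xq; rewrite PE QE -!cat_rcons !cat_path => /andP[xp1 _] /andP[xq1 _].
  move: xp1; rewrite rcons_path => /andP[-> ->] /=.
  have : path (@adj T) (last x (rcons q1 c)) (rev (belast x (rcons q1 c))).
    by rewrite rev_path; apply: sub_path xq1 => ? ?; rewrite adj_sym.
  by rewrite last_rcons belast_rcons rev_cons rcons_path.
move: up uq; rewrite PE QE /= !cat_uniq !mem_cat /= !inE !negb_or.
move=> /andP[/and3P[x1 xc _] /and3P[u1 n1 /andP[cp2 _]]].
move=> /andP[/and3P[y1 _ _] /and3P[v1 m1 _]].
move: n1 m1 => /andP[-> n1] /andP[cq1 _].
rewrite !mem_rev rev_uniq x1 xc y1 u1 cq1 v1 !andbT /=.
apply/hasPn => t; rewrite mem_rev => tq; apply: contra nq1 => tp.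
by apply/hasP; exists t => //; rewrite /= PE mem_cat tp.
Qed.

Lemma upath_size x p : path (@adj T) x p -> uniq (x :: p) -> size p = dist x (last x p).
Proof.
move=> xp up; have [q [xq lq sq]] := distP x (last x p).
have uq : uniq (x :: q) by apply: geodesic_uniq; rewrite ?lq.
by rewrite -sq; congr size; apply: (upath_inj xp up xq uq).
Qed.

(** Geodesics from [w1] and [w2] to [x], with [v] put in front, are simple paths with the same ends,
    hence equal. *)
Lemma closer_uniq x v w1 w2 : adj v w1 -> adj v w2 ->
  dist x v = (dist x w1).+1 -> dist x v = (dist x w2).+1 -> w1 = w2.
Proof.
move=> a1 a2 d1 d2.
have [p1 [wp1 l1 s1]] := distP w1 x; have [p2 [wp2 l2 s2]] := distP w2 x.
have g w p : adj v w -> dist x v = (dist x w).+1 -> path (@adj T) w p -> last w p = x ->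
    size p = dist w x -> path (@adj T) v (w :: p) /\ uniq (v :: w :: p).
  move=> vw d wp l s; have vp : path (@adj T) v (w :: p) by rewrite /= vw.
  by split=> //; apply: geodesic_uniq => //=; rewrite l s distC [RHS]distC d.
have [vp1 u1] := g _ _ a1 d1 wp1 l1 s1; have [vp2 u2] := g _ _ a2 d2 wp2 l2 s2.
suff: w1 :: p1 = w2 :: p2 by case.
by apply: (upath_inj vp1 u1 vp2 u2); rewrite /= l1 l2.
Qed.

(** Were the distances equal, [w] would not lie on a geodesic from [v] to [x]; putting it in front
    would give a simple path longer than the distance, but simple paths are geodesics. *)
Lemma dist_adj_neq x v w : adj v w -> dist x v <> dist x w.
Proof.
move=> vw e; have [p [vp l s]] := distP v x.
have up : uniq (v :: p) by apply: geodesic_uniq; rewrite ?l.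
have : uniq (w :: v :: p).
  rewrite cons_uniq up andbT inE negb_or eq_sym adj_neq//=.
  apply/negP => wp; case/splitPr: wp vp l s up => p1 p2.
  rewrite cat_path last_cat /= => /and3P[_ _ wp2] l s _.
  have := dist_le wp2; rewrite l distC -e distC -s size_cat /=; lia.
move=> /(@upath_size w (v :: p)); rewrite /= vp adj_sym vw => /(_ isT).
by rewrite l s !(distC _ x) e; lia.
Qed.

Lemma dist_adj x v w : adj v w ->
  dist x w = (dist x v).+1 \/ dist x v = (dist x w).+1.
Proof.
move=> vw; have := @dist_adj_neq x _ _ vw.
have := dist_triangle v x w; have := dist_triangle w x v.
rewrite (distC w v) (adj_dist vw); lia.
Qed.

(** The edge from [p] to [z] separates [v], on the side of [z], from [r], on the side of [p].
    Induction on the distance from [v] to [z]: if [v] were closer to [r] than the next vertex [v'],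
    it would be the neighbour of [v'] toward [p], yet it is farther from [p]. *)
Lemma dist_separate p z v r : adj p z -> dist v p = (dist v z).+1 ->
  dist r z = (dist r p).+1 -> dist v r = dist v z + (dist p r).+1.
Proof.
move=> pz + rz; move dn: (dist v z) => n; elim: n v dn => [|n IH] v dz dp.
  move/eqP: dz; rewrite dist_eq0 => /eqP ->.
  by rewrite add0n -(distC r p) -rz distC.
have [v' vv' dv'] : exists2 w, adj v w & dist z v = (dist z w).+1.
  by apply: dist_closer; rewrite -dist_eq0 dz.
have d'z : dist v' z = n by move: dv'; rewrite !(distC z) dz; lia.
have d'p : dist v' p = n.+1.
  have := dist_triangle v' v p; have := dist_triangle z v' p.
  by rewrite (adj_dist vv') (distC z p) (adj_dist pz); lia.
have IHv := IH _ d'z d'p.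
have [] := dist_adj r vv'; rewrite !(distC r); last by lia.
move=> dr; have [v'' a'' d''] : exists2 w, adj v' w & dist p v' = (dist p w).+1.
  by apply: dist_closer; rewrite -dist_eq0 d'p.
suff E : v = v'' by move: d''; rewrite -E !(distC p); lia.
apply: (@closer_uniq r v'); rewrite ?(adj_sym v' v) // !(distC r) //.
have := dist_triangle p v'' r; have [] := dist_adj r a''; rewrite !(distC r).
  by move: d''; rewrite !(distC p v') (distC p v''); lia.
by [].
Qed.

End TreeDistance.

(** * Ends and Busemann functions *)

Section Busemann.
Variable T : tree.
Implicit Types (x y z v p : vertex T) (r s : nat -> vertex T) (w : End T).

(** Distances from the origin suffice: a shortcut between two later points would shorten the way
    from [s 0]. *)
Lemma rayP s : rays s <->
  (forall k, adj (s k) (s k.+1)) /\ (forall k, dist (s 0%N) (s k) = k).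
Proof.
split=> [rs|[adjs d0] m n mn].
  by split=> k; rewrite -?dist1 rs// ?subn0// subSnn.
have le k : (dist (s m) (s (m + k)) <= k)%N.
  elim: k => [|k IH]; first by rewrite addn0 distxx.
  apply: leq_trans (dist_triangle (s (m + k)%N) _ _) _.
  by rewrite addnS (adj_dist (adjs _)); lia.
have := le (n - m)%N; rewrite subnKC//.
by have := dist_triangle (s m) (s 0%N) (s n); rewrite !d0; lia.
Qed.

Lemma ray_shift s m : rays s -> rays (fun k => s (m + k)%N).
Proof. by move=> rs a b ab; rewrite rs; lia. Qed.

(** The distance to [v] changes by one at each step and cannot decrease forever. After one increase
    it always increases, since a decrease would make the ray turn back. *)
Lemma ray_escape v s : rays s ->
  exists K, forall k, dist v (s (K + k)%N) = (dist v (s K) + k)%N.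
Proof.
move=> rs; have [adjs _] := (rayP s).1 rs.
have [K HK] : exists K, dist v (s K.+1) = (dist v (s K)).+1.
  apply: contrapT => /forallNP N.
  have dec k : (dist v (s k) + k = dist v (s 0%N))%N.
    elim: k => [|k IH]; first by rewrite addn0.
    by have [/N//|] := dist_adj v (adjs k); lia.
  by have := dec (dist v (s 0%N)).+1; lia.
have inc k : dist v (s (K + k).+1) = (dist v (s (K + k)%N)).+1.
  elim: k => [|k IH]; first by rewrite addn0.
  rewrite addnS; have [//|bad] := dist_adj v (adjs (K + k).+1).
  have : s (K + k)%N = s (K + k).+2.
    by apply: (@closer_uniq _ v (s (K + k).+1)) => //; rewrite 1?adj_sym.
  move=> /eqP; rewrite -dist_eq0 rs; lia.
by exists K; elim=> [|k IH]; rewrite ?addn0// addnS inc IH addnS.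
Qed.

Lemma end_rays w r : val w r -> rays r.
Proof. by case: w => w /= /set_mem[r0 _ ->] []. Qed.

Lemma end_ray w : exists r, val w r.
Proof.
case: w => w /= /set_mem[r0 r0r ->]; exists r0; split=> //.
by exists 0%N, 0%N.
Qed.

Lemma end_coincide w r s : val w r -> val w s -> eventually_coincide r s.
Proof.
case: w => w /= /set_mem[r0 _ ->] [_ [m1 [n1 E1]]] [_ [m2 [n2 E2]]].
exists (n1 + m2)%N, (n2 + m1)%N => k.
by rewrite -!addnA -E1 -E2 !addnA (addnC m1).
Qed.

Lemma end_closed w r s : val w r -> rays s -> eventually_coincide r s -> val w s.
Proof.
case: w => w /= /set_mem[r0 _ ->] [_ [m1 [n1 E1]]] rs [m2 [n2 E2]].
split=> //; exists (m1 + m2)%N, (n2 + n1)%N => k.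
by rewrite -!addnA E1 -E2 !addnA (addnC m2).
Qed.

Lemma end_of_ray r : rays r -> exists w, val w r.
Proof.
move=> rr; pose W := [set s | rays s /\ eventually_coincide r s].
have HW : W \in @ends T by apply/mem_set; exists r.
by exists (exist _ W HW); split=> //; exists 0%N, 0%N.
Qed.

(** Join a geodesic from [v] to a point of some ray of [w] beyond which the distance from [v] only
    grows. *)
Lemma ray_from v w : exists2 r, val w r & r 0%N = v.
Proof.
have [r wr] := end_ray w; have rr := end_rays wr.
have [K HK] := ray_escape v rr.
have [p [vp lp sp]] := distP v (r K).
pose s k := if (k <= size p)%N then nth v (v :: p) k else r (K + (k - size p))%N.
have spk k : s (size p + k)%N = r (K + k)%N.
  rewrite /s; case: leqP => [|_]; last by congr r; lia.
  case: k => [|k]; last by lia.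
  by rewrite !addn0 leqnn -last_nth lp.
exists s; last by [].
apply: (end_closed wr); last by exists K, (size p) => k; rewrite spk.
have adjs k : adj (s k) (s k.+1).
  have [kp|kp] := ltnP k (size p).
    by rewrite /s (ltnW kp) kp; move/(pathP v): vp => /(_ _ kp).
  rewrite -(subnKC kp) -addnS !spk addnS.
  by have [+ _] := (rayP r).1 rr; apply.
have s0 : s 0%N = v by [].
apply/rayP; split=> // k; rewrite s0.
have le a b : (dist (s a) (s (a + b)%N) <= b)%N.
  elim: b => [|b IH]; first by rewrite addn0 distxx.
  apply: leq_trans (dist_triangle (s (a + b)%N) _ _) _.
  by rewrite addnS (adj_dist (adjs _)); lia.
have [kp|kp] := leqP (size p) k.
  by rewrite -(subnKC kp) spk HK sp.
have := le 0%N k; have := le k (size p - k)%N; rewrite subnKC ?(ltnW kp)// add0n.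
have -> : s (size p) = r K by rewrite -[size p]addn0 spk addn0.
rewrite s0.
by have := dist_triangle (s k) v (r K); rewrite -sp; lia.
Qed.

(** Only differences are prescribed, so [b] is determined up to a constant; it grows toward the
    end. *)
Definition busemann w (b : vertex T -> int) := forall v v0 r, val w r ->
  \forall k \near \oo, (dist v0 (r k))%:Z - (dist v (r k))%:Z = b v - b v0.

(** On one ray [s], [b v] is the eventual value of [k] minus the distance from [v] to [s k]. Any
    other ray of [w] is eventually a shift of [s], and the shift cancels in differences. *)
Lemma busemann_exists w : exists b, busemann w b.
Proof.
have [s ws] := end_ray w; have rs := end_rays ws.
have /choice[b Hb] : forall v, exists n : int, exists K, forall k, (K <= k)%N ->
    k%:Z - (dist v (s k))%:Z = n.
  move=> v; have [K HK] := ray_escape v rs; exists (K%:Z - (dist v (s K))%:Z), K => k Kk.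
  by rewrite -(subnKC Kk) HK; lia.
exists b => v v0 r wr.
have [K HK] := Hb v; have [K0 HK0] := Hb v0.
have [m [n E]] := end_coincide ws wr.
exists (n + K + K0)%N => // k /= nk.
have -> : r k = s (m + (k - n))%N by rewrite E; congr r; lia.
have := HK (m + (k - n))%N; have := HK0 (m + (k - n))%N.
lia.
Qed.

Lemma indexV_busemann w b v v0 : busemann w b -> indexV v v0 w = b v - b v0.
Proof.
move=> wb; rewrite /indexV; case: xgetP => [n -> [r [wr _ [K _ HK]]]|/(_ (b v - b v0))].
  have [L _ HL] := wb v v0 r wr.
  by rewrite -(HK (K + L)%N) ?HL//=; lia.
have [r wr r0] := ray_from v0 w; case; exists r; split=> //; exact: wb.
Qed.

(** * Heights, parents and upper ends of edges for a fixed end *)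

Section BusemannFunction.
Variables (w : End T) (b : vertex T -> int).
Hypothesis wb : busemann w b.

Lemma busemann_adj x y : adj x y -> b y = b x + 1 \/ b x = b y + 1.
Proof.
move=> xy; have [r wr] := end_ray w; have [K _ /(_ K (leqnn _)) /=] := wb x y wr.
by have := dist_adj (r K) xy; rewrite !(distC (r K)); lia.
Qed.

Lemma busemann_parent v : exists2 y, adj v y & b y = b v + 1.
Proof.
have [r wr r0] := ray_from v w; have rr := end_rays wr.
have [adjs _] := (rayP r).1 rr; exists (r 1%N); first by rewrite -r0.
have [K _ /(_ K.+1 (leqnSn _))/=] := wb (r 1%N) v wr.
by rewrite -{1}r0 !rr//; lia.
Qed.

(** Both are the neighbour of [v] closer to a far point of a ray to [w]. *)
Lemma busemann_parent_uniq v y1 y2 : adj v y1 -> adj v y2 ->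
  b y1 = b v + 1 -> b y2 = b v + 1 -> y1 = y2.
Proof.
move=> a1 a2 b1 b2; have [r wr] := end_ray w.
have [K1 _ /(_ (K1 + _)%N) H1] := wb y1 v wr.
have [K2 _ /(_ (_ + K2)%N) H2] := wb y2 v wr.
apply: (@closer_uniq _ (r (K1 + K2)%N) v) => //; rewrite !(distC (r _)).
  by have := H1 K2 (leq_addr _ _); lia.
by have := H2 K1 (leq_addl _ _); lia.
Qed.

Lemma edge_end_busemann (e : edge T) x y : adj x y -> val e = [set x; y] ->
  b y = b x + 1 -> edge_end e w = y.
Proof.
move=> xy eE bxy.
have inE v : val e v <-> v = x \/ v = y by rewrite eE.
apply: xget_unique => [|v [/inE[vx|//] Hv]].
  split=> [|v' r /inE[->|->]// _ wr]; first by apply/inE; right.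
  by have [L _ HL] := wb y x wr; exists L => //= k /HL /=; lia.
subst v; have [r wr] := end_ray w; have ey : val e y by apply/inE; right.
have yx : y <> x by apply/eqP; rewrite eq_sym adj_neq.
have [K _ HK] := Hv y r ey yx wr; have [L _ HL] := wb y x wr.
have := HK (K + L)%N (leq_addr _ _); have := HL (K + L)%N (leq_addl _ _) => /=; lia.
Qed.

Lemma edgeP (e : edge T) : exists x y, [/\ adj x y, b y = b x + 1, val e = [set x; y]
  & edge_end e w = y].
Proof.
have [x [y [xy eE]]] : edges (val e) by apply: set_mem; case: e.
have [bxy|byx] := busemann_adj xy.
  by exists x, y; split=> //; apply: (edge_end_busemann xy eE).
have eE' : val e = [set y; x] by rewrite eE setUC.
have yx : adj y x by rewrite adj_sym.
by exists y, x; split=> //; apply: (edge_end_busemann yx eE').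
Qed.

(* If the parent of v is farther from x than v, then v lies on the ray from x to the
   end, so its height is at least that of x. *)
Lemma busemann_toward x v y : adj v y -> dist x v = (dist x y).+1 -> b v < b x ->
  b y = b v + 1.
Proof.
suff key n : forall v y, dist x v = n -> adj v y -> b y = b v + 1 ->
    dist x y = n.+1 -> b v = b x + n%:Z.
  move=> vy dv bv; have [z vz bz] := busemann_parent v.
  have [dz|dz] := dist_adj x vz.
    by have := key _ _ _ erefl vz bz dz; lia.
  by rewrite (closer_uniq vy vz dv dz).
elim: n => [|n IH] {}v {}y dv vy bvy dy.
  by move/eqP: dv; rewrite dist_eq0 => /eqP ->; lia.
have [z vz dz] : exists2 z, adj v z & dist x v = (dist x z).+1.
  by apply: dist_closer; rewrite eq_sym -dist_eq0 dv.
have [bz|bz] := busemann_adj vz.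
  by have := busemann_parent_uniq vy vz bvy bz => E; move: dz; rewrite -E; lia.
have zv : adj z v by rewrite adj_sym.
have zn : dist x z = n by lia.
by have := IH z v zn zv bz dv; lia.
Qed.

End BusemannFunction.

(** The ends beyond the oriented edge [(p, z)]: the ray from [z] moves away from [p]. *)
Definition through p z w :=
  exists r, [/\ val w r, r 0%N = z & forall k, dist p (r k) = k.+1].

(** From the side of [p], every geodesic to a far point of the ray passes through [z]. *)
Lemma through_busemann p z w b v : adj p z -> through p z w -> busemann w b ->
  dist v z = (dist v p).+1 -> b v = b z - (dist v z)%:Z.
Proof.
move=> pz [r [wr r0 rp]] wb dv; have [K _ /(_ K (leqnn _))/=] := wb v z r wr.
have rz : dist (r K) z = K by rewrite distC -r0 (end_rays wr)// subn0.
have := @dist_separate _ p z (r K) v pz.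
rewrite rz (distC (r K) p) rp => /(_ erefl dv).
rewrite (distC v (r K)) (distC z) rz (distC p); lia.
Qed.

(** Put [z] in front of the ray from [c]; the edge from [z] to [c] separates the later points from
    [p]. *)
Lemma through_child p z c w : adj p z -> adj z c -> c != p -> through z c w ->
  through p z w.
Proof.
move=> pz zc cp [r [wr r0 rp]].
pose s k := if k is k'.+1 then r k' else z.
have pc : dist p c = (dist p z).+1.
  have [//|dz] := dist_adj p zc; move: dz; rewrite (adj_dist pz) => -[/esym/eqP].
  by rewrite dist_eq0 eq_sym (negPf cp).
exists s; split=> //.
  apply: (end_closed wr); last by exists 0%N, 1%N.
  apply/rayP; split=> [[|k]|[|k]] /=; rewrite ?r0 ?distxx ?rp//.
  by have [+ _] := (rayP r).1 (end_rays wr); apply.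
case=> [|k] /=; first exact: adj_dist.
have rc : dist (r k) c = k by rewrite distC -r0 (end_rays wr)// subn0.
have rz : dist (r k) z = (dist (r k) c).+1 by rewrite rc distC.
have := dist_separate zc rz pc.
by rewrite rc (distC z p) (adj_dist pz) distC => ->; lia.
Qed.

(** A walk that never turns back moves away from [p] forever. *)
Lemma through_exists p z : (forall x y, exists2 c, adj x c & c != y) -> adj p z ->
  exists w, through p z w.
Proof.
move=> br pz.
have /choice[nxt Hn] : forall e : vertex T * vertex T, exists c, adj e.2 c /\ c != e.1.
  by move=> [x y]; have [c] := br y x; exists c.
pose st k := iter k (fun e => (e.2, nxt e)) (p, z).
have H k : adj (st k).1 (st k).2 /\ dist p (st k).1 = k /\ dist p (st k).2 = k.+1.
  elim: k => [|k [a [d1 d2]]]; first by rewrite /= distxx (adj_dist pz).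
  rewrite /=; have [a' n'] := Hn (st k); split=> //; split=> //.
  have [->|] := dist_adj p a'; first by rewrite d2.
  rewrite -[X in X = _]/(dist p (st k).2) => dd.
  have a1 : adj (st k).2 (st k).1 by rewrite adj_sym.
  by move: n'; rewrite (closer_uniq a' a1 dd) ?eqxx// d1.
have r0 : rays (fun k => (st k).1).
  apply/rayP; split=> k; last by have [_ []] := H k.
  exact: (H k).1.
have r1 := ray_shift 1 r0.
have [w ww] := end_of_ray r1; exists w, (fun k => (st (1 + k)%N).1); split=> // k.
by have [_ []] := H k.
Qed.

End Busemann.

(** * Level sums on branches *)

Definition nbrs (T : tree) (z : vertex T) : seq (vertex T) :=
  enum_fset (fset_set [set y | adj z y]).

(* Covers both cases of the theorem: t is constant and s the identity when T is
   homogeneous, t is the type and s the negation when T is semi-homogeneous. *)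
Definition typed_regular (T : tree) (t : vertex T -> bool) (s : bool -> bool)
    (q : bool -> nat) :=
  [/\ forall a, (0 < q a)%N, forall x y, adj x y -> t y = s (t x)
    & forall x, has_degree x (q (t x)).+1].

Lemma regular_typed (T : tree) : homogeneous T \/ semihomogeneous T ->
  exists t s q, @typed_regular T t s q.
Proof.
case=> [[q q0 degq]|[qp [qm [s [qp0 qm0 alt deg]]]]].
  by exists (fun=> true), id, (fun=> q).
exists s, negb, (fun a => if a then qp else qm); split=> // [[]//|x].
by have := deg x; case: ifP.
Qed.

Section Branches.
Variables (R : realType) (T : tree) (t : vertex T -> bool) (s : bool -> bool).
Variable q : bool -> nat.
Hypothesis reg : typed_regular t s q.
Implicit Types (p z v c : vertex T) (f g : vertex T -> vertex T -> R).

Lemma nbrs_finite z : finite_set [set y | adj z y].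
Proof. by have [_ _ /(_ z) d] := reg; exists (q (t z)).+1. Qed.

Lemma mem_nbrs z y : (y \in nbrs z) = adj z y.
Proof.
rewrite -[LHS]/(y \in fset_set _) in_fset_set; last exact: nbrs_finite.
by apply/idP/idP => [/set_mem|/mem_set].
Qed.

Lemma nbrs_uniq z : uniq (nbrs z). Proof. exact: fset_uniq. Qed.

Lemma size_nbrs z : size (nbrs z) = (q (t z)).+1.
Proof.
have [_ _ /(_ z) d] := reg.
exact: (card_fset_set d).
Qed.

Lemma nbr_neq x y : exists2 c : vertex T, adj x c & c != y.
Proof.
have [q0 _ _] := reg; have := size_nbrs x; have := nbrs_uniq x.
have M c : c \in nbrs x -> adj x c by rewrite mem_nbrs.
case: (nbrs x) M => [|a [|b l]] M //=; first by have := q0 (t x); lia.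
rewrite inE negb_or -andbA => /and3P[ab _ _] _.
have [E|ay] := eqVneq a y; last by exists a => //; apply: M; rewrite mem_head.
by exists b; [apply: M; rewrite !inE eqxx orbT|rewrite -E eq_sym].
Qed.

Definition children p z := [seq c <- nbrs z | c != p].

Lemma children_uniq p z : uniq (children p z).
Proof. exact/filter_uniq/nbrs_uniq. Qed.

Lemma mem_children p z c : (c \in children p z) = (c != p) && adj z c.
Proof. by rewrite mem_filter mem_nbrs. Qed.

Lemma size_children p z : adj p z -> size (children p z) = q (t z).
Proof.
move=> pz; have zp : p \in nbrs z by rewrite mem_nbrs adj_sym.
rewrite /children -rem_filter ?nbrs_uniq// size_rem// size_nbrs//.
Qed.

(** An operator on functions of oriented edges; its [m]-th iterate sums over the descendants of
    [(p, z)] at depth [m]. *)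
Definition child_sum f p z : R := \sum_(c <- children p z) f z c.

Lemma eq_iter_child_sum m f g p z : adj p z ->
  (forall a b, adj a b -> f a b = g a b) ->
  iter m child_sum f p z = iter m child_sum g p z.
Proof.
move=> + fg; elim: m p z => [|m IH] p z pz /=; first exact: fg.
rewrite /child_sum !big_seq; apply: eq_bigr => c; rewrite mem_children => /andP[_ zc].
exact: IH.
Qed.

Lemma le_iter_child_sum m f g p z : adj p z ->
  (forall a b, adj a b -> f a b <= g a b) ->
  iter m child_sum f p z <= iter m child_sum g p z.
Proof.
move=> + fg; elim: m p z => [|m IH] p z pz /=; first exact: fg.
rewrite /child_sum !big_seq; apply: ler_sum => c; rewrite mem_children => /andP[_ zc].
exact: IH.
Qed.

Lemma norm_iter_child_sum m f p z :
  `|iter m child_sum f p z| <= iter m child_sum (fun a b => `|f a b|) p z.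
Proof.
elim: m p z => [|m IH] p z //=; apply: le_trans (ler_norm_sum _ _ _) _.
by apply: ler_sum => c _; exact: IH.
Qed.

Lemma iter_child_sumD m f g p z :
  iter m child_sum (fun a b => f a b + g a b) p z =
  iter m child_sum f p z + iter m child_sum g p z.
Proof.
elim: m p z => [|m IH] p z //=; rewrite /child_sum -big_split.
by apply: eq_bigr => c _; exact: IH.
Qed.

(** All descendants at depth [m] end in a vertex of the same type, so a factor depending on the type
    comes out of the sum. *)
Lemma iter_child_sum_scale m (h : bool -> R) f p z : adj p z ->
  iter m child_sum (fun a b => h (t b) * f a b) p z =
  h (iter m s (t z)) * iter m child_sum f p z.
Proof.
have [_ ts _] := reg; elim: m p z => [|m IH] p z pz //=.
rewrite /child_sum big_distrr/= !big_seq; apply: eq_bigr => c.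
by rewrite mem_children => /andP[_ zc]; rewrite IH// (ts _ _ zc) -iterSr.
Qed.

(** The equation places [v] on the side of [z] of the edge; [P] selects distances from [z]. *)
Definition branch (P : pred nat) p z : set (vertex T) :=
  [set v | dist v p = (dist v z).+1 /\ P (dist v z)].

(** Without [z], the side of [z] is the disjoint union of the branches of the children, on which
    distances drop by one. *)
Lemma branch_child_sum (P : pred nat) (u : vertex T -> R) p z : adj p z ->
  rsummable u -> child_sum (fun a b => rsum (branch P a b) u) p z =
  rsum (branch (fun n => (0 < n)%N && P n.-1) p z) u.
Proof.
move=> pz su; apply/esym; apply: rsum_cover; rewrite ?children_uniq//.
  move=> a b v; rewrite !mem_children => /andP[_ za] /andP[_ zb] [da _] [db _].
  exact: (closer_uniq za zb da db).
move=> v; split=> [[dp /andP[d0 Pd]]|[c]].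
  have [c zc dc] : exists2 c, adj z c & dist v z = (dist v c).+1.
    by apply: dist_closer; rewrite eq_sym -dist_eq0 -lt0n.
  exists c; last by split=> //; rewrite dc in Pd.
  rewrite mem_children zc andbT; apply: contra_eq_neq dp => <-; rewrite dc; lia.
rewrite mem_children => /andP[cp zc] [dc Pd]; rewrite /branch /= dc /=; split=> //.
have zp : adj z p by rewrite adj_sym.
have [->|dp] := dist_adj v zp; first by rewrite dc.
by rewrite (closer_uniq zc zp dc dp) eqxx in cp.
Qed.

(** * Estimates for the level sums of a summable function *)

Section Levels.
Variable u : vertex T -> R.
Hypothesis su : rsummable u.

(** The number $B_n(p, z)$ of the introduction. *)
Definition level n p z := rsum (branch (pred1 n) p z) u.

(** A common bound for the absolute values of all levels from [n] on. *)
Definition tail n p z := rsum (branch (leq n) p z) (fun v => `|u v|).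

Lemma child_sum_level n p z : adj p z -> child_sum (level n) p z = level n.+1 p z.
Proof.
move=> pz; rewrite /level branch_child_sum//; congr rsum; apply/seteqP.
by split=> v [dp H]; split=> //; move: H; rewrite /=; case: (dist v z).
Qed.

Lemma child_sum_tail n p z : adj p z -> child_sum (tail n) p z = tail n.+1 p z.
Proof.
move=> pz; rewrite /tail branch_child_sum//; last exact: rsummable_norm.
congr rsum; apply/seteqP.
by split=> v [dp H]; split=> //; move: H; rewrite /=; case: (dist v z).
Qed.

Lemma iter_child_sum_level m n p z : adj p z ->
  iter m child_sum (level n) p z = level (n + m)%N p z.
Proof.
elim: m n p z => [|m IH] n p z pz; first by rewrite addn0.
rewrite iterSr (@eq_iter_child_sum _ _ (level n.+1))//; last exact: child_sum_level.
by rewrite IH// addSnnS.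
Qed.

Lemma level0 p z : adj p z -> level 0 p z = u z.
Proof.
move=> pz; rewrite /level (_ : branch _ _ _ = [set z]) ?rsum_set1//.
apply/seteqP; split=> [v [_ /=]|v ->]; first by rewrite dist_eq0 => /eqP.
by split; rewrite /= distxx// distC (adj_dist pz).
Qed.

Lemma norm_level n m p z : (m <= n)%N -> `|level n p z| <= tail m p z.
Proof.
move=> mn; apply: le_trans (ler_norm_rsum _ su) _; apply: rsum_subset => //.
  exact: rsummable_norm.
by move=> v [dp /eqP dn]; split=> //; rewrite /= dn.
Qed.

(** [S] is the sum over the sphere of radius [n.+1] about [z]. Each reversed child edge misses one
    branch of this sphere, and [S] itself splits into the sides of [z] and of [p]. *)
Lemma child_sum_rev_level n p z : adj p z ->
  child_sum (fun a b => level n.+1 b a) p z =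
  ((q (t z))%:R - 1) * level n.+1 p z + (q (t z))%:R * level n z p.
Proof.
move=> pz; pose S := \sum_(c <- nbrs z) level n z c.
have SE c : adj z c -> level n.+1 c z = S - level n z c.
  move=> zc; rewrite -child_sum_level ?[adj c z]adj_sym// /child_sum big_filter.
  by rewrite /S (bigD1_seq c)/= ?mem_nbrs ?nbrs_uniq// addrAC subrr add0r.
have zp : adj z p by rewrite adj_sym.
rewrite /child_sum big_seq.
under eq_bigr => c.
  rewrite mem_children => /andP[_ zc]; rewrite SE//; over.
rewrite -big_seq sumrB big_const_seq count_predT size_children// iter_addr_0.
rewrite -/(child_sum (level n) p z) child_sum_level// -mulr_natl.
have -> : S = level n.+1 p z + level n z p by rewrite (SE p)// subrK.
ring.
Qed.

(* Only heights below [b z] are required: the reduction of the edge transform to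
   vertices provides no others. *)
Definition null_through k p z := forall w b i, through p z w -> busemann w b ->
  (k < i)%N -> rsum [set v | b v = b z - i%:Z] u = 0.

(** The child [c] is one higher than [z], so depth [i] below [c] is depth [i.-1] below [z]; this is
    why [k] grows by one. *)
Lemma null_through_child k p z c : adj p z -> c \in children p z ->
  null_through k p z -> null_through k.+1 z c.
Proof.
move=> pz; rewrite mem_children => /andP[cp zc] H w b i wc wb ki.
have bc : b z = b c - 1.
  by rewrite (through_busemann zc wc wb (v := z)) ?distxx (adj_dist zc).
rewrite -(H w b i.-1 (through_child pz zc cp wc) wb); last by lia.
by congr rsum; apply/seteqP; split=> v /=; lia.
Qed.

Lemma null_through_level k n p z : adj p z -> null_through k p z -> (k <= n)%N ->
  `|level n z p| <= tail 0 p z.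
Proof.
move=> pz H kn; have [w pzw] := through_exists nbr_neq pz.
have [b wb] := busemann_exists w; have := H w b n.+1 pzw wb kn.
(* On the side of [p], the horosphere [n.+1] below [z] is the level [n] seen from [p]; its other
   part lies on the side of [z] and is bounded by the tail. *)
rewrite (rsumID [set v | dist v z = (dist v p).+1])// (_ : _ `&` _ = branch (pred1 n) z p).
  move=> /eqP; rewrite addr_eq0 => /eqP E; rewrite /level E normrN.
  apply: le_trans (ler_norm_rsum _ su) _; apply: rsum_subset => //.
    exact: rsummable_norm.
  move=> v [_ /= dv]; split=> //; by have [] := dist_adj v pz.
apply/seteqP; split=> v /= [A B]; move: (through_busemann pz pzw wb (v := v)).
  by move=> /(_ B); split=> //=; apply/eqP; move: A; lia.
by move=> /(_ A); split=> //; move/eqP: B; lia.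
Qed.

(** The bounds at the descendants add up to the tail from depth [m] on; hence the sums $K_m$ tend to
    [0]. *)
Lemma null_through_iter m k n p z : adj p z -> null_through k p z -> (k <= n)%N ->
  `|iter m child_sum (fun a b => level (n + m)%N b a) p z| <= tail m p z.
Proof.
elim: m k n p z => [|m IH] k n p z pz H kn.
  by rewrite addn0; exact: null_through_level H kn.
rewrite /= -child_sum_tail//; apply: le_trans (ler_norm_sum _ _ _) _.
rewrite /child_sum !big_seq; apply: ler_sum => c cpz.
have zc : adj z c by move: cpz; rewrite mem_children => /andP[].
rewrite -addSnnS; apply: (IH k.+1) => //; exact: null_through_child cpz H.
Qed.

(** The recursion for $K_m$: reverse the innermost child sum, then collect the levels [n + m.+1] at
    depth [m] into level [n + m.*2.+1]. *)
Lemma iter_child_sum_rev_level m n p z : adj p z ->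
  iter m.+1 child_sum (fun a b => level (n + m.+1)%N b a) p z =
  ((q (iter m s (t z)))%:R - 1) * level (n + m.*2.+1)%N p z +
  (q (iter m s (t z)))%:R * iter m child_sum (fun a b => level (n + m)%N b a) p z.
Proof.
move=> pz; rewrite iterSr addnS (@eq_iter_child_sum _ _ (fun a b =>
    ((q (t b))%:R - 1) * level (n + m).+1 a b +
    (q (t b))%:R * level (n + m)%N b a))//; last first.
  by move=> a b ab; rewrite child_sum_rev_level.
rewrite iter_child_sumD (iter_child_sum_scale m (fun a => (q a)%:R - 1))//.
rewrite (iter_child_sum_scale m (fun a => (q a)%:R))// iter_child_sum_level//.
by congr (_ * level _ _ _ + _); lia.
Qed.

(** Downward induction on [m] from [M]: the recursion bounds $|Q K_m|$ by $e + (Q - 1) e = Q e$, and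
    $K_0$ is [level n z p]. *)
Lemma level_bound_step (e : R) n p z : adj p z -> null_through 0 p z ->
  (forall j, (n < j)%N -> `|level j p z| <= e) ->
  (exists M, forall m, (M <= m)%N -> tail m p z <= e) ->
  `|level n z p| <= e.
Proof.
move=> pz H Le [M HM]; have [q0 _ _] := reg.
pose K m := iter m child_sum (fun a b => level (n + m)%N b a) p z.
suff: forall k m, (M <= m + k)%N -> `|K m| <= e.
  by move=> /(_ M 0%N); rewrite /K /= addn0 add0n; apply.
elim=> [|k IH] m.
  rewrite addn0 => Mm; apply: le_trans (HM _ Mm).
  exact: null_through_iter H (leq0n n).
rewrite -addSnnS => /IH; rewrite /K iter_child_sum_rev_level//.
rewrite -/(K m); set Q := q _; have := Le (n + m.*2.+1)%N.
rewrite ler_norml => /(_ _)/andP[]; first by lia.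
set L := level _ _ _; rewrite !ler_norml => L1 L2 /andP[K1 K2].
have Q1 : 1 <= Q%:R :> R by rewrite ler1n; exact: q0.
have h1 : 0 <= (Q%:R - 1) * (e - L) by rewrite mulr_ge0; lra.
have h2 : 0 <= (Q%:R - 1) * (e + L) by rewrite mulr_ge0; lra.
have Q0 : 0 < Q%:R :> R by lra.
apply/andP; split; rewrite -(ler_pM2l Q0); lra.
Qed.

Lemma null_through_eq0 p z : adj p z -> null_through 0 p z -> null_through 0 z p ->
  u z = 0.
Proof.
move=> pz Hz Hp; have zp : adj z p by rewrite adj_sym.
suff: forall e : R, 0 < e -> `|u z| <= e.
  move=> H; apply/eqP; rewrite -normr_le0; apply/ler_addgt0Pl => e e0.
  by rewrite addr0; exact: H.
move=> e e0; have [N1 H1] := rsum_tail (dist z) su e0.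
have [N2 H2] := rsum_tail (dist p) su e0.
have tz m : (N1 <= m)%N -> tail m p z <= e.
  by move=> Nm; apply: (H1 _ _ Nm) => v [_ /=]; rewrite distC.
have tp m : (N2 <= m)%N -> tail m z p <= e.
  by move=> Nm; apply: (H2 _ _ Nm) => v [_ /=]; rewrite distC.
(* Downward induction on [j], for both orientations at once: each level is controlled by the higher
   levels of the reversed edge. *)
suff: forall k j, (N1 + N2 <= j + k)%N -> `|level j p z| <= e /\ `|level j z p| <= e.
  by move=> /(_ (N1 + N2)%N 0%N (leqnn _)) []; rewrite level0.
elim=> [|k IH] j Nj.
  by split; apply: le_trans (norm_level _ _ (leqnn j)) _; [apply: tz|apply: tp]; lia.
split; [apply: level_bound_step zp Hp _ _|apply: level_bound_step pz Hz _ _].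
- by move=> i ji; apply: (IH i _).2; lia.
- by exists N2.
- by move=> i ji; apply: (IH i _).1; lia.
- by exists N1.
Qed.

End Levels.
End Branches.
Arguments child_sum {R T} f p z.

(** * Edges and flags *)

Section EdgesAndFlags.
Variable T : tree.
Implicit Types (x y z v p : vertex T) (e : edge T) (f g : flag T) (w : End T).

Lemma edge_exists x y : adj x y -> exists e, val e = [set x; y].
Proof.
move=> xy; have H : [set x; y] \in @edges T by apply/mem_set; exists x, y.
by exists (exist _ [set x; y] H).
Qed.

Lemma edge_adj e : exists x y, adj x y /\ val e = [set x; y].
Proof. by apply: set_mem; case: e. Qed.

Lemma edge_inj e e' : val e = val e' -> e = e'.
Proof. exact: val_inj. Qed.

Lemma flag_exists e v : val e v -> exists f, flagE f = e /\ flagV f = v.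
Proof.
move=> ev; have H : (e, v) \in @flags T by apply/mem_set.
by exists (exist _ (e, v) H).
Qed.

Lemma flag_incident f : val (flagE f) (flagV f).
Proof. by have : flags (val f) by apply: set_mem; case: f. Qed.

Lemma flag_inj f g : flagE f = flagE g -> flagV f = flagV g -> f = g.
Proof.
rewrite /flagE /flagV => fgE fgV; apply: val_inj.
by rewrite (surjective_pairing (val f)) (surjective_pairing (val g)) fgE fgV.
Qed.

Lemma set2_other x y y' : [set x; y] = [set x; y'] -> x != y -> y = y'.
Proof.
move=> E xy; have : [set x; y'] y by rewrite -E; right.
by case=> // yx; rewrite yx eqxx in xy.
Qed.

(** Flags are treated as oriented edges, here the flag at [x] pointing to [y]; [f0] is a dummy when
    [x] and [y] are not adjacent. *)
Definition to_flag f0 x y : flag T :=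
  xget f0 [set f | val (flagE f) = [set x; y] /\ flagV f = x].

Lemma to_flagP f0 x y : adj x y ->
  val (flagE (to_flag f0 x y)) = [set x; y] /\ flagV (to_flag f0 x y) = x.
Proof.
move=> xy; apply: (@xgetPex _ f0 [set f | val (flagE f) = [set x; y] /\ flagV f = x]).
have [e eE] := edge_exists xy.
have [|f [fe fv]] := @flag_exists e x; first by rewrite eE; left.
by exists f; rewrite /= fe.
Qed.

Lemma to_flag_eq f0 x y f : adj x y -> val (flagE f) = [set x; y] -> flagV f = x ->
  f = to_flag f0 x y.
Proof.
move=> xy fe fv; have [E V] := to_flagP f0 xy.
by apply: flag_inj; [apply: edge_inj; rewrite E|rewrite V].
Qed.

Lemma flag_to_flag f0 f : exists2 y, adj (flagV f) y & f = to_flag f0 (flagV f) y.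
Proof.
have [x [y [xy fe]]] := edge_adj (flagE f); have := flag_incident f; rewrite fe.
case=> fv; [exists y|exists x]; rewrite fv ?[adj y x]adj_sym//; apply: to_flag_eq => //.
  by rewrite adj_sym.
by rewrite fe setUC.
Qed.

Lemma edge_fibre_finite e : finite_set (@flagE T @^-1` [set e]).
Proof.
have [x [y [xy eE]]] := edge_adj e.
have [|f [fe fv]] := @flag_exists e x; first by rewrite eE; left.
have [|g [ge gv]] := @flag_exists e y; first by rewrite eE; right.
apply: (@sub_finite_set _ _ [set f; g]); last exact: finite_set2.
move=> h /= he; have := flag_incident h; rewrite he eE.
by case=> hv; [left|right]; apply: flag_inj; congruence.
Qed.

End EdgesAndFlags.

(** * Injectivity of the projection to edges and vertices *)

Section TypedTree.
Variables (R : realType) (T : tree) (t : vertex T -> bool) (s : bool -> bool).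
Variable q : bool -> nat.
Hypothesis reg : typed_regular t s q.
Implicit Types (x y z v p : vertex T) (e : edge T) (f g : flag T) (w : End T).

Lemma vertex_fibre_finite v : finite_set (@flagV T @^-1` [set v]).
Proof.
have [->|/set0P[f0 fv0]] := eqVneq (@flagV T @^-1` [set v]) set0; first exact: finite_set0.
apply: (@sub_finite_set _ _ (to_flag f0 v @` [set y | adj v y])); last first.
  exact/finite_image/(nbrs_finite reg).
by move=> f /= fv; have [y vy fE] := flag_to_flag f0 f; exists y; rewrite ?fv -?fv.
Qed.

Lemma proj_real_inj (a : flag T -> R) : rsummable a ->
  (forall e, rsum (@flagE T @^-1` [set e]) a = 0) ->
  (forall v, rsum (@flagV T @^-1` [set v]) a = 0) -> forall f, a f = 0.
Proof.
move=> sa HE HV f0; pose fl := to_flag f0; pose phi x y := a (fl x y).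
(* The zero sums at edges make [phi] a flow; those at vertices, in [div], make it free of
   sources. *)
have anti x y : adj x y -> phi x y = - phi y x.
  move=> xy; have [e eE] := edge_exists xy; have yx : adj y x by rewrite adj_sym.
  have [E1 V1] := to_flagP f0 xy; have [E2 V2] := to_flagP f0 yx.
  apply/eqP; rewrite -addr_eq0 -(HE e); apply/eqP.
  rewrite (@rsum_cover _ _ _ [:: x; y] (fun v => [set if v == x then fl x y else fl y x])).
  - by rewrite !big_cons big_nil !rsum_set1 eqxx eq_sym (negPf (adj_neq xy)) addr0.
  - exact: sa.
  - by rewrite /= inE adj_neq.
  - move=> i j f; rewrite !inE => /orP[]/eqP-> /orP[]/eqP->//;
      rewrite eqxx eq_sym (negPf (adj_neq xy)) => /= -> /(congr1 (@flagV T));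
      by rewrite V1 V2 => /eqP; rewrite ?[y == x]eq_sym (negPf (adj_neq xy)).
  - move=> f; split=> [/= fe|[v]].
      have := flag_incident f; rewrite fe eE => -[]fv; [exists x|exists y];
        rewrite ?mem_head// ?inE ?eqxx ?orbT//=.
        by apply: to_flag_eq; rewrite ?fe.
      rewrite eq_sym (negPf (adj_neq xy)).
      by apply: to_flag_eq; rewrite ?fe// eE setUC.
    rewrite !inE => /orP[]/eqP->; rewrite ?eqxx 1?eq_sym ?(negPf (adj_neq xy)) => /= ->;
      apply: edge_inj; rewrite eE ?E1 ?E2//.
    by rewrite setUC.
have div z : \sum_(c <- nbrs z) phi z c = 0.
  rewrite -[RHS](HV z) (@rsum_cover _ _ _ (nbrs z) (fun c => [set fl z c])).
  - by apply: eq_bigr => c _; rewrite rsum_set1.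
  - exact: sa.
  - exact: nbrs_uniq.
  - move=> c d f; rewrite !(mem_nbrs reg) => zc zd /= -> /(congr1 (@flagE T))/(congr1 val).
    have [-> _] := to_flagP f0 zc; have [-> _] := to_flagP f0 zd.
    by move=> /set2_other; apply; exact: adj_neq.
  - move=> f; split=> [/= fv|[c]].
      have [y + fE] := flag_to_flag f0 f; rewrite fv => zy.
      by exists y; rewrite ?(mem_nbrs reg)//= fE fv.
    by rewrite (mem_nbrs reg) => zc /= ->; have [_ ->] := to_flagP f0 zc.
have fix_phi m x y : adj x y -> iter m child_sum phi x y = phi x y.
  elim: m x y => [//|m IH] x y xy; rewrite iterSr.
  rewrite (@eq_iter_child_sum _ _ _ _ _ reg m _ phi)// ?IH// => p z pz.
  have zp : adj z p by rewrite adj_sym.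
  have := div z; rewrite (bigD1_seq p)/= ?(mem_nbrs reg) ?nbrs_uniq// (anti z p)//.
  by rewrite -big_filter => /eqP; rewrite addrC subr_eq0 => /eqP <-.
(* [G] dominates the flow at each vertex, so the total flow at depth [N] is at most a level sum of
   [G], which is small. *)
pose G v := rsum (@flagV T @^-1` [set v]) (fun f => `|a f|).
have sG : rsummable G by apply/rsummable_fibre/rsummable_norm.
have phiG x y : adj x y -> `|phi x y| <= level G 0 x y.
  move=> xy; rewrite level0// anti// normrN /G.
  rewrite -(rsum_set1 (fl y x) (fun f => `|a f|)); apply: rsum_subset => //.
    exact: rsummable_norm.
  have yx : adj y x by rewrite adj_sym.
  by move=> f /= ->; have [_ ->] := to_flagP f0 yx.
have [y vy fE] := flag_to_flag f0 f0; rewrite fE -/(phi (flagV f0) y).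
set v := flagV f0 in vy *; apply/eqP; rewrite -normr_le0; apply/ler_addgt0Pl => e e0.
rewrite addr0; have [N /(_ N _ (leqnn _)) HN] := rsum_tail (dist y) sG e0.
rewrite -(fix_phi N)//; apply: le_trans (norm_iter_child_sum _ _ _ _) _.
apply: le_trans (le_iter_child_sum reg N vy phiG) _.
rewrite (iter_child_sum_level reg)// add0n.
apply: le_trans (ler_norm _) _; apply: le_trans (norm_level sG v y (leqnn N)) _.
by apply: HN => c [_ /=]; rewrite distC.
Qed.

End TypedTree.

(** * Horospheres *)

Section Horospheres.
Variables (R : realType) (T : tree) (X : choiceType) (I : zmodType).
Variable index : X -> X -> End T -> I.

Lemma horosphere_level (h : set_type (horospheres index)) (g : X -> I) :
  (forall x x0, index x x0 (val h).1 = g x - g x0) ->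
  exists n, (val h).2 = [set x | g x = n].
Proof.
move=> ig; have [_ [x0 [n E]]] : horospheres index (val h) by apply: set_mem; case: h {ig}.
exists (n + g x0); rewrite E; apply/seteqP; split=> x /=; rewrite ig.
  by move=> <-; rewrite subrK.
by move=> ->; rewrite addrK.
Qed.

Lemma horosphere_nonempty (h : set_type (horospheres index)) : (val h).2 !=set0.
Proof. by have [] : horospheres index (val h) by apply: set_mem; case: h. Qed.

Lemma horosphere_exists w (g : X -> I) x :
  (forall x x0, index x x0 w = g x - g x0) ->
  exists h : set_type (horospheres index), val h = (w, [set y | g y = g x]).
Proof.
move=> ig; have H : (w, [set y | g y = g x]) \in horospheres index.
  apply/mem_set; split; first by exists x.
  exists x, 0; apply/seteqP; split=> y /=; rewrite ig.
    by move=> ->; rewrite subrr.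
  by move=> /eqP; rewrite subr_eq0 => /eqP.
by exists (exist _ (w, [set y | g y = g x]) H).
Qed.

Lemma rsum_level_eq0 (u : X -> R) w (g : X -> I) n :
  (forall x x0, index x x0 w = g x - g x0) ->
  (forall h : set_type (horospheres index), rsum (val h).2 u = 0) ->
  rsum [set x | g x = n] u = 0.
Proof.
move=> ig H; have [->|/set0P[x /= <-]] := eqVneq [set x | g x = n] set0.
  exact: rsum_set0.
by have [h hE] := horosphere_exists x ig; rewrite -(H h) hE.
Qed.

End Horospheres.

(** The exceptional point is meant for [edge_toward], whose base point repeats the value of a
    neighbour. *)
Lemma rsummable_comp_inj (R : realType) (X Y : choiceType) (f : X -> Y) (x0 : X)
  (u : Y -> R) : set_inj (~` [set x0]) f -> rsummable u -> rsummable (u \o f).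
Proof.
move=> fi su; rewrite /rsummable /summable (esumID [set x0])// setTI setTI.
rewrite esum_set1// lte_add_pinfty ?ltry//.
rewrite -(esum_image _ f (fun y => `|(u y)%:E|%E))//.
exact: le_lt_trans (esum_subset _ (@subsetT _ _)) su.
Qed.

(** * Indexing edges by vertices, to reduce edge sums to vertex sums *)

Section EdgeTransform.
Variable T : tree.
Implicit Types (x y z v p : vertex T) (e : edge T) (w : End T).

(** The default [e0] is not a dummy: it is the value at [v = x]. *)
Definition edge_toward e0 x v : edge T :=
  xget e0 [set e | exists y,
    [/\ adj v y, dist x v = (dist x y).+1 & val e = [set v; y]]].

Lemma edge_towardP e0 x v y : adj v y -> dist x v = (dist x y).+1 ->
  val (edge_toward e0 x v) = [set v; y].
Proof.
move=> vy dy.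
have [] : [set e | exists y, [/\ adj v y, dist x v = (dist x y).+1 & val e = [set v; y]]]
    (edge_toward e0 x v).
  by apply: xgetPex; have [e eE] := edge_exists vy; exists e; exists y.
by move=> z [vz dz ->]; rewrite (closer_uniq vy vz dy dz).
Qed.

Arguments edge_towardP {e0 x v y}.

Lemma edge_toward_self e0 x : edge_toward e0 x x = e0.
Proof. by apply: xgetPN => e [y []]; rewrite distxx. Qed.

(** From [x] and from [y] both sides give [e0]; from any other vertex the geodesics to [x] and [y]
    leave by the same edge. *)
Lemma edge_toward_sym e0 x y v : adj x y -> val e0 = [set x; y] ->
  edge_toward e0 x v = edge_toward e0 y v.
Proof.
wlog dv : x y / dist v y = (dist v x).+1 => [wl|] xy e0E.
  have [d|d] := dist_adj v xy; first exact: wl.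
  by apply/esym/wl; rewrite 1?adj_sym// setUC.
have [->|vx] := eqVneq v x.
  rewrite edge_toward_self; apply: edge_inj; rewrite (edge_towardP xy)//.
  by rewrite distxx distC (adj_dist xy).
have [c vc dc] := dist_closer vx.
apply: edge_inj; rewrite (edge_towardP vc dc) (edge_towardP vc)//.
have := dist_triangle x y c; have [|//] := dist_adj y vc.
by rewrite (distC y x) (adj_dist xy) !(distC y) ; move: dc; rewrite !(distC x); lia.
Qed.

Lemma edge_toward_inj e0 x : set_inj (~` [set x]) (edge_toward e0 x).
Proof.
move=> v v' /set_mem/= /eqP vx /set_mem/= /eqP vx' E.
have [c vc dc] := dist_closer vx; have [c' vc' dc'] := dist_closer vx'.
have := congr1 val E; rewrite (edge_towardP vc dc) (edge_towardP vc' dc') => S.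
have : [set v'; c'] v by rewrite -S; left.
have : [set v; c] v' by rewrite S; left.
by case=> // vE; case=> // vE'; move: dc dc'; rewrite -vE -vE'; lia.
Qed.

(* Below the height of x the edge from v toward x is the edge from v to its parent. *)
Lemma edge_toward_bij e0 x w b n : busemann w b -> n < b x ->
  set_bij [set v | b v = n] [set e | b (edge_end e w) = n + 1] (edge_toward e0 x).
Proof.
move=> wb nx; have key v : b v = n -> exists c,
    [/\ adj v c, b c = n + 1 & val (edge_toward e0 x v) = [set v; c]].
  move=> bv; have vx : v != x by apply: contraTneq nx => <-; rewrite bv ltxx.
  have [c vc dc] := dist_closer vx; exists c; split=> //.
    by rewrite (busemann_toward wb vc dc) ?bv.
  exact: edge_towardP.
split.
- move=> v /= bv; have [c [vc bc eE]] := key _ bv.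
  by rewrite (edge_end_busemann wb vc eE) ?bc ?bv.
- move=> v v' /set_mem/= bv /set_mem/= bv' E.
  have [c [vc bc eE]] := key _ bv; have [c' [vc' bc' eE']] := key _ bv'.
  have : [set v'; c'] v by rewrite -eE' -E eE; left.
  by case=> // vE; move: bc'; rewrite -vE bv; lia.
- move=> e /=; have [v [y [vy bvy eE ->]]] := edgeP wb e => by_.
  have bv : b v = n by lia.
  exists v => //; have [c [vc bc eE']] := key _ bv.
  apply: edge_inj; rewrite eE' eE; congr [set _; _].
  by apply: (busemann_parent_uniq wb vc vy) => //; lia.
Qed.

End EdgeTransform.

(** * Injectivity of the vertex and edge transforms on real functions *)

Section RadonInjective.
Variables (R : realType) (T : tree) (t : vertex T -> bool) (s : bool -> bool).
Variable q : bool -> nat.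
Hypothesis reg : typed_regular t s q.

Lemma radonV_real_inj (u : vertex T -> R) : rsummable u ->
  (forall h : HV T, rsum (val h).2 u = 0) -> forall v, u v = 0.
Proof.
move=> su H z; have [p zp _] := nbr_neq reg z z.
have null x y : null_through u 0 x y.
  move=> w b i _ wb _; apply: (rsum_level_eq0 (index := @indexV T) (w := w)) => //.
  by move=> v v0; exact: indexV_busemann.
by apply: (null_through_eq0 reg su (p := p)) => //; rewrite adj_sym.
Qed.

Lemma radonE_real_inj (u : edge T -> R) : rsummable u ->
  (forall h : HE T, rsum (val h).2 u = 0) -> forall e, u e = 0.
Proof.
move=> su H e; have [x [y [xy eE]]] := edge_adj e.
have null z y' : null_through (u \o edge_toward e z) 0 y' z.
  move=> w b i _ wb i0.
  rewrite -(rsum_bij _ (edge_toward_bij e wb (x := z) _)); last by lia.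
  apply: (rsum_level_eq0 (index := @indexE T) (w := w) (g := fun e => b (edge_end e w))) => //.
  by move=> e1 e2; exact: indexV_busemann.
rewrite -(edge_toward_self e x) -/((u \o edge_toward e x) x).
apply: (null_through_eq0 reg _ (p := y)); rewrite 1?adj_sym//.
  by apply: rsummable_comp_inj su; exact: edge_toward_inj.
(* The orientation with head [y] requires the base point [y]; symmetry makes both base points give
   the same function. *)
suff -> : u \o edge_toward e x = u \o edge_toward e y by [].
by apply/funext => v /=; rewrite (edge_toward_sym v xy eE).
Qed.

End RadonInjective.

(* The common part of the two commutative squares: pi stands for flagV or flagE,
   gX and gY are heights of flags and of their projections. *)
Lemma rsum_flag_horospheres (R : realType) (T : tree) (Y : choiceType) (J : zmodType)
    (index : Y -> Y -> End T -> J) (pi : flag T -> Y) (gX : flag T -> int * int)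
    (gY : Y -> J) (h : set_type (horospheres index)) (a : flag T -> R) :
  rsummable a ->
  (forall f f0, indexF f f0 (val h).1 = gX f - gX f0) ->
  (forall y y0, index y y0 (val h).1 = gY y - gY y0) ->
  (forall f f', gX f = gX f' -> gY (pi f) = gY (pi f')) ->
  (forall f y, gY (pi f) = gY y -> exists2 f', pi f' = y & gX f' = gX f) ->
  (forall n, finite_set (gX @` [set f | gY (pi f) = n])) ->
  let K := [set k : HF T | ((val k).1, pi @` (val k).2) = val h] in
  finite_set K /\
  \sum_(k \in K) rsum (val k).2 a = rsum (pi @^-1` (val h).2) a.
Proof.
move=> sa iX iY gXY gYX fin K.
have [n hE] := horosphere_level iY.
have levelK k : K k -> (val k).1 = (val h).1 /\
    exists m, [/\ (val k).2 = [set f | gX f = m] & (gX @` [set f | gY (pi f) = n]) m].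
  move=> Kk; have k1 : (val k).1 = (val h).1 by have := congr1 fst Kk.
  have k2 : pi @` (val k).2 = (val h).2 by have := congr1 snd Kk.
  have [m kE] : exists m, (val k).2 = [set f | gX f = m].
    by apply: horosphere_level => f f0; rewrite k1.
  split=> //; exists m; split=> //; have [f kf] := horosphere_nonempty k.
  have : (val h).2 (pi f) by rewrite -k2; exists f.
  by rewrite hE => fn; exists f => //; move: kf; rewrite kE.
have finK : finite_set K.
  pose S := (fun m => ((val h).1, [set f | gX f = m])) @` (gX @` [set f | gY (pi f) = n]).
  have finS : finite_set S by apply: finite_image.
  apply: (@sub_finite_set _ _ ((val : HF T -> _) @^-1` S)).
    move=> k /levelK[k1 [m [k2 mS]]]; exists m => //.
    by rewrite -k1 -k2 -surjective_pairing.
  by apply: finite_preimage finS => ? ? _ _; exact: val_inj.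
split=> //; rewrite fsbig_finite//=; apply/esym.
have memK k : k \in enum_fset (fset_set K) <-> K k.
  rewrite -[k \in _]/(k \in fset_set K) in_fset_set//.
  by split=> [/set_mem|/mem_set].
apply: rsum_cover => //; first exact: fset_uniq.
  move=> k k' f /memK /levelK[k1 [m [kE _]]] /memK /levelK[k1' [m' [kE' _]]].
  rewrite kE kE' /= => fm fm'; apply: val_inj.
  rewrite (surjective_pairing (val k)) (surjective_pairing (val k')) k1 k1'.
  by rewrite kE kE' -fm -fm'.
move=> f; split=> [/= hf|[k /memK Kk kf]]; last first.
  by rewrite /= -[(val h).2]/((val h).2) -(congr1 snd Kk) /=; exists f.
(* The flag-horosphere through [f] projects onto all of [h], because each point of [h] has a lift of
   the same height as [f]. *)
have [k kE] := horosphere_exists f iX.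
exists k; last by rewrite kE.
apply/memK; rewrite /K /= kE [RHS]surjective_pairing; congr pair.
rewrite hE; rewrite hE /= in hf; apply/seteqP; split=> [y [f' /= ff' <-]|y /= yn].
  by rewrite (gXY _ _ ff').
by have [f' <- ff'] := gYX f y (etrans hf (esym yn)); exists f'.
Qed.

(** * The vertex and edge squares of the diagram *)

Section Commute.
Variables (R : realType) (T : tree) (t : vertex T -> bool) (s : bool -> bool).
Variable q : bool -> nat.
Hypothesis reg : typed_regular t s q.

Let height w (b : vertex T -> int) (f : flag T) : int * int :=
  (b (edge_end (flagE f) w), b (flagV f)).

Lemma indexF_busemann w b (f f0 : flag T) : busemann w b ->
  indexF f f0 w = height w b f - height w b f0.
Proof. by move=> wb; rewrite /indexF /indexE !(indexV_busemann _ _ wb). Qed.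

(** The vertex of a flag is the upper or the lower end of its edge; these two cases are why the
    projections of horospheres are two-to-one. *)
Lemma flag_height w b (f : flag T) : busemann w b ->
  b (edge_end (flagE f) w) = b (flagV f) \/ b (edge_end (flagE f) w) = b (flagV f) + 1.
Proof.
move=> wb; have [x [y [xy bxy fe ->]]] := edgeP wb (flagE f).
by have := flag_incident f; rewrite fe => -[->|->]; [right|left].
Qed.

Lemma rsum_flag_horospheresV (h : HV T) (a : flag T -> R) : rsummable a ->
  finite_set [set k : HF T | horoV k = val h] /\
  \sum_(k \in [set k : HF T | horoV k = val h]) rsum (val k).2 a =
  rsum (@flagV T @^-1` (val h).2) a.
Proof.
move=> sa; have [b wb] := busemann_exists (val h).1; move: wb.
set w := (val h).1 => wb.
apply: (rsum_flag_horospheres (index := @indexV T) (pi := @flagV T)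
  (gX := height w b) (gY := b)) => //.
- by move=> f f0; exact: indexF_busemann.
- by move=> v v0; exact: indexV_busemann.
- by move=> f f' [].
- move=> f v fv; have [ef|ef] := flag_height f wb.
    have [p vp bp] := busemann_parent wb v.
    (* Here [v] must be the upper end of the lifted edge, so a neighbour other than the parent is
       taken; in the other case the edge to the parent serves. *)
    have [c vc cp] := nbr_neq reg v p.
    have cv : adj c v by rewrite adj_sym.
    have bc : b v = b c + 1.
      have [bc|//] := busemann_adj wb vc.
      by rewrite (busemann_parent_uniq wb vc vp bc bp) eqxx in cp.
    have [e eE] := edge_exists cv.
    have [|f' [fe' fv']] := @flag_exists _ e v; first by rewrite eE; right.
    exists f' => //; rewrite /height fe' fv' ef fv.
    by rewrite (edge_end_busemann wb cv eE bc).
  have [p vp bp] := busemann_parent wb v; have [e eE] := edge_exists vp.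
  have [|f' [fe' fv']] := @flag_exists _ e v; first by rewrite eE; left.
  exists f' => //; rewrite /height fe' fv' ef fv.
  by rewrite (edge_end_busemann wb vp eE bp) bp.
- move=> n; apply: (@sub_finite_set _ _ [set (n, n); (n + 1, n)]); last exact: finite_set2.
  by move=> _ [f /= fn <-]; rewrite /height -fn; have [->|->] := flag_height f wb; [left|right].
Qed.

Lemma rsum_flag_horospheresE (h : HE T) (a : flag T -> R) : rsummable a ->
  finite_set [set k : HF T | horoE k = val h] /\
  \sum_(k \in [set k : HF T | horoE k = val h]) rsum (val k).2 a =
  rsum (@flagE T @^-1` (val h).2) a.
Proof.
move=> sa; have [b wb] := busemann_exists (val h).1; move: wb.
set w := (val h).1 => wb.
apply: (rsum_flag_horospheres (index := @indexE T) (pi := @flagE T)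
  (gX := height w b) (gY := fun e => b (edge_end e w))) => //.
- by move=> f f0; exact: indexF_busemann.
- by move=> e e0; exact: indexV_busemann.
- by move=> f f' [].
- move=> f e fe; have [x [y [xy bxy eE ey]]] := edgeP wb e.
  have [ef|ef] := flag_height f wb.
    have [|f' [fe' fv']] := @flag_exists _ e y; first by rewrite eE; right.
    by exists f' => //; rewrite /height fe' fv' fe -ef fe ey.
  have [|f' [fe' fv']] := @flag_exists _ e x; first by rewrite eE; left.
  exists f' => //; rewrite /height fe' fv' fe; congr pair.
  by move: ef; rewrite fe ey; lia.
- move=> n; apply: (@sub_finite_set _ _ [set (n, n); (n, n - 1)]); last exact: finite_set2.
  move=> _ [f /= fn <-]; rewrite /height -fn.
  by have [->|->] := flag_height f wb; [left|right; rewrite addrK].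
Qed.

End Commute.

(** * The diagram *)

Section ComplexParts.
Variable R : realType.
Implicit Types (X : choiceType) (z : R[i]).

(** A boolean index lets one argument treat both real parts of a complex sum. *)
Definition cpart (c : bool) z : R := if c then complex.Re z else complex.Im z.

Lemma cpart_inj z z' : (forall c, cpart c z = cpart c z') -> z = z'.
Proof.
by move=> H; apply/eqP; rewrite eq_complex; apply/andP; split; apply/eqP;
  [exact: (H true)|exact: (H false)].
Qed.

Lemma cpartD c z z' : cpart c (z + z') = cpart c z + cpart c z'.
Proof. by case: z z' c => [a b] [a' b'] []. Qed.

Lemma cpart_sum c (I : Type) (r : seq I) (u : I -> R[i]) :
  cpart c (\sum_(i <- r) u i) = \sum_(i <- r) cpart c (u i).
Proof. by apply: (big_morph (cpart c) (cpartD c)); case: c. Qed.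

Lemma cpart_fsum c X (A : set X) (u : X -> R[i]) : finite_set A ->
  cpart c (\sum_(x \in A) u x) = \sum_(x \in A) cpart c (u x).
Proof. by move=> fA; rewrite !fsbig_finite// cpart_sum. Qed.

Lemma cpart_csum c X (A : set X) (u : X -> R[i]) :
  cpart c (csum A u) = rsum A (cpart c \o u).
Proof. by case: c. Qed.

Lemma cpart_le_normc c z : `|cpart c z| <= ComplexField.Normc.normc z.
Proof.
by case: z c => [a b] []; rewrite /= -sqrtr_sqr ler_wsqrtr// (lerDl, lerDr) sqr_ge0.
Qed.

Lemma normc_le_cpart z :
  ComplexField.Normc.normc z <= `|cpart true z| + `|cpart false z|.
Proof.
case: z => a b /=; rewrite -[leRHS]ger0_norm ?addr_ge0// -sqrtr_sqr ler_wsqrtr//.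
by rewrite sqrrD !real_normK ?num_real// -addrA lerD2l lerDr mulrn_wge0// mulr_ge0.
Qed.

Lemma l1P X (u : X -> R[i]) : l1 R X u <-> forall c, rsummable (cpart c \o u).
Proof.
split=> [lu c|H].
  apply: (rsummable_le (v := fun x => ComplexField.Normc.normc (u x))) lu => x /=.
  by rewrite (le_trans (cpart_le_normc c (u x)))// ler_norm.
have := rsummableD (rsummable_norm (H true)) (rsummable_norm (H false)).
apply: rsummable_le => x; rewrite [leLHS]ger0_norm.
  by rewrite [leRHS]ger0_norm ?addr_ge0//; exact: normc_le_cpart.
exact: le_trans (normr_ge0 _) (cpart_le_normc true _).
Qed.

Lemma csum_inj X (S : set (set X)) (u v : X -> R[i]) :
  (forall a : X -> R, rsummable a -> (forall A, S A -> rsum A a = 0) -> forall x, a x = 0) ->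
  l1 R X u -> l1 R X v -> (forall A, S A -> csum A u = csum A v) -> u = v.
Proof.
move=> inj /l1P su /l1P sv uv; apply/funext => x; apply: cpart_inj => c.
apply/eqP; rewrite -subr_eq0; apply/eqP.
apply: (inj (fun x => cpart c (u x) - cpart c (v x))).
  exact: (rsummableB (su c) (sv c)).
move=> A SA; rewrite (rsumB _ (su c) (sv c)); apply/eqP; rewrite subr_eq0; apply/eqP.
by rewrite -!cpart_csum uv.
Qed.

End ComplexParts.

(** * Commutativity and inversion for complex functions *)

Section Diagram.
Variables (R : realType) (T : tree) (t : vertex T -> bool) (s : bool -> bool).
Variable q : bool -> nat.
Hypothesis reg : typed_regular t s q.

Lemma cpart_projV c (u : flag T -> R[i]) : l1 R (flag T) u ->
  cpart c \o projV u = fun v => rsum (@flagV T @^-1` [set v]) (cpart c \o u).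
Proof.
move=> /l1P su; apply/funext => v; rewrite /= /projV.
have fin := vertex_fibre_finite reg v.
by rewrite cpart_fsum// rsum_finite//; exact: (su c).
Qed.

Lemma cpart_projE c (u : flag T -> R[i]) : l1 R (flag T) u ->
  cpart c \o projE u = fun e => rsum (@flagE T @^-1` [set e]) (cpart c \o u).
Proof.
move=> /l1P su; apply/funext => e; rewrite /= /projE.
have fin := edge_fibre_finite e.
by rewrite cpart_fsum// rsum_finite//; exact: (su c).
Qed.

Lemma projV_l1 (u : flag T -> R[i]) : l1 R (flag T) u -> l1 R (vertex T) (projV u).
Proof.
move=> lu; apply/l1P => c; rewrite cpart_projV//.
by apply: rsummable_fibre; move/l1P: lu.
Qed.

Lemma projE_l1 (u : flag T -> R[i]) : l1 R (flag T) u -> l1 R (edge T) (projE u).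
Proof.
move=> lu; apply/l1P => c; rewrite cpart_projE//.
by apply: rsummable_fibre; move/l1P: lu.
Qed.

(** Both sides at [h] are the sum of [u] over all flags whose vertex lies on [h]. *)
Lemma projHV_radonF (u : flag T -> R[i]) : l1 R (flag T) u ->
  projHV (radonF u) = radonV (projV u).
Proof.
move=> lu; have su := (l1P _).1 lu; apply/funext => h; apply: cpart_inj => c.
have [fin E] := rsum_flag_horospheresV reg h (su c).
rewrite /projHV cpart_fsum// cpart_csum cpart_projV// -rsum_preimage//.
by rewrite -E; apply: eq_fsbigr => k _; rewrite cpart_csum.
Qed.

Lemma projHE_radonF (u : flag T -> R[i]) : l1 R (flag T) u ->
  projHE (radonF u) = radonE (projE u).
Proof.
move=> lu; have su := (l1P _).1 lu; apply/funext => h; apply: cpart_inj => c.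
have [fin E] := rsum_flag_horospheresE h (su c).
rewrite /projHE cpart_fsum// cpart_csum cpart_projE// -rsum_preimage//.
by rewrite -E; apply: eq_fsbigr => k _; rewrite cpart_csum.
Qed.

Lemma radonV_inj : set_inj (l1 R (vertex T)) (@radonV R T).
Proof.
move=> u v /set_mem lu /set_mem lv E.
apply: (@csum_inj _ _ [set A | exists h : HV T, (val h).2 = A]) => //.
  by move=> a sa H; apply: (radonV_real_inj reg sa) => h; apply: H; exists h.
by move=> _ [h <-]; exact: (congr1 (@^~ h) E).
Qed.

Lemma radonE_inj : set_inj (l1 R (edge T)) (@radonE R T).
Proof.
move=> u v /set_mem lu /set_mem lv E.
apply: (@csum_inj _ _ [set A | exists h : HE T, (val h).2 = A]) => //.
  by move=> a sa H; apply: (radonE_real_inj reg sa) => h; apply: H; exists h.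
by move=> _ [h <-]; exact: (congr1 (@^~ h) E).
Qed.

Lemma projEV_inj : set_inj (l1 R (flag T)) (@projEV R T).
Proof.
move=> u v /set_mem lu /set_mem lv [EE EV].
apply: (@csum_inj _ _ [set A | (exists e, @flagE T @^-1` [set e] = A) \/
                              (exists v, @flagV T @^-1` [set v] = A)]) => //.
  move=> a sa H; apply: (proj_real_inj reg sa) => y; apply: H; first by left; exists y.
  by right; exists y.
move=> _ [] [y <-]; apply: cpart_inj => c; rewrite !cpart_csum.
  by have := congr1 (fun g => (cpart c \o g) y) EE; rewrite !cpart_projE.
by have := congr1 (fun g => (cpart c \o g) y) EV; rewrite !cpart_projV.
Qed.

Lemma projHEV_radonF (u : flag T -> R[i]) : l1 R (flag T) u ->
  projHEV (radonF u) = prodmap (@radonE R T) (@radonV R T) (projEV u).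
Proof. by move=> lu; rewrite /projHEV projHE_radonF// projHV_radonF. Qed.

(** By commutativity [radonF u] determines the edge and vertex transforms of the projections of [u],
    hence the projections, hence [u]. *)
Lemma radonF_inj : set_inj (l1 R (flag T)) (@radonF R T).
Proof.
move=> u v lu lv E; apply: projEV_inj => //.
have [lu' lv'] := (set_mem lu, set_mem lv).
have := congr1 (@projHEV R T) E; rewrite !projHEV_radonF// => -[EE EV].
by congr pair; [apply: radonE_inj EE|apply: radonV_inj EV]; apply/mem_set;
  [exact: projE_l1|exact: projE_l1|exact: projV_l1|exact: projV_l1].
Qed.

Lemma radon_inv_projHEV (u : flag T -> R[i]) : l1 R (flag T) u ->
  prodmap (@radonE_inv R T) (@radonV_inv R T) (projHEV (radonF u)) = projEV u.
Proof.
move=> lu; rewrite projHEV_radonF// /prodmap /= /radonE_inv /radonV_inv.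
rewrite (pinvKV _ radonE_inj) ?(pinvKV _ radonV_inj)//; apply/mem_set.
  exact: projV_l1.
exact: projE_l1.
Qed.

End Diagram.

Theorem theorem5p2p10 (R : realType) (T : tree)
    (hT : homogeneous T \/ semihomogeneous T) :
  (* commutativity of the diagram *)
  [/\ set_fun (l1 R (flag T)) (l1 R (edge T) `*` l1 R (vertex T)) (@projEV R T)
    & {in l1 R (flag T),
         @projHEV R T \o @radonF R T
           =1 prodmap (@radonE R T) (@radonV R T) \o @projEV R T}] /\
  (* injectivity of the maps to be inverted *)
  [/\ set_inj (l1 R (edge T)) (@radonE R T),
      set_inj (l1 R (vertex T)) (@radonV R T),
      set_inj (l1 R (flag T)) (@projEV R T)
    & set_inj (l1 R (flag T)) (@radonF R T)] /\
  (* the right-hand side is defined on the image of l1(F) under R_F, and is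
     the inverse of R_F *)
  [/\ set_fun (@radonF R T @` l1 R (flag T))
        ((@radonE R T @` l1 R (edge T)) `*` (@radonV R T @` l1 R (vertex T)))
        (@projHEV R T),
      set_fun (@radonF R T @` l1 R (flag T)) (@projEV R T @` l1 R (flag T))
        (prodmap (@radonE_inv R T) (@radonV_inv R T) \o @projHEV R T)
    & {in @radonF R T @` l1 R (flag T),
         @radonF_inv R T
           =1 @projEV_inv R T \o prodmap (@radonE_inv R T) (@radonV_inv R T)
                \o @projHEV R T}].
Proof.
have [t [s [q reg]]] := regular_typed hT.
split; [|split].
- split=> [u lu|u /set_mem lu]; last exact: projHEV_radonF reg u lu.
  by split; [exact: projE_l1|exact: projV_l1 reg _ lu].
- split.
  + exact: radonE_inj reg.
  + exact: radonV_inj reg.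
  + exact: projEV_inj reg.
  + exact: radonF_inj reg.
- split=> [_ [u lu <-]|_ [u lu <-]|_ /set_mem[u lu <-]].
  + rewrite (projHEV_radonF reg)//; split=> /=.
      by exists (projE u) => //; exact: projE_l1.
    by exists (projV u) => //; exact: projV_l1 reg _ lu.
  + by exists u => //=; rewrite (radon_inv_projHEV reg).
  (* Both sides reduce to [u], each partial inverse cancelling on the image of [l1]. *)
  + rewrite /= (radon_inv_projHEV reg)// /radonF_inv /projEV_inv.
    by rewrite (pinvKV _ (radonF_inj reg)) ?(pinvKV _ (projEV_inj reg)) ?mem_set.
Qed.
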